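(* Let $f:\mathbb{R}^2\to\mathbb{R}$ be a continuous function, and let $\Im=\{f^{-1}(c)\mid c\in f(\mathbb{R}^2)\}$ be the partition of $\mathbb{R}^2$ by level sets of $f$. Suppose the following two conditions hold. (1) For each $c\in f(\mathbb{R}^2)$ belonging to the image of $f$, the corresponding level set $f^{-1}(c)$ is a curve. In particular, it is path connected. (2) The family of curves $\Im$ is regular. Then the image $f(\mathbb{R}^2)$ is an open interval $(a,b)$, $a,b\in\mathbb{R}\cup\{\pm\infty\}$, and there is a homeomorphism $\varphi:\mathbb{R}\times(a,b)\to\mathbb{R}^2$ such that $f\circ\varphi(x,y)=y$. In other words, $f$ is topologically equivalent to a projection.
   Context: A curve in $\mathbb{R}^2$ is a homeomorphic image of the open interval $(0,1)$. For an open subset $U\subset\mathbb{R}^2$, a family of curves in $U$ is a partition of $U$ whose elements are curves. A family of curves $\Im$ in $U$ is called regular at a point $p$ if there exist an open neighbourhood $U_p$ of $p$ and a homeomorphism $\psi:(0,1)\times(0,1)\to U_p$ such that for every $y\in(0,1)$ the image $\psi((0,1)\times\{y\})$ is an intersection of $U_p$ with some curve from the family $\Im$. The family is regular if it is regular at every point. Two continuous functions $f,g:M\to\mathbb{R}$ on a connected surface $M$ (here $M=\mathbb{R}^2$) are called topologically equivalent if there exist two homeomorphisms $h:M\to M$ and $k:\mathbb{R}\to\mathbb{R}$ such that $k\circ f=g\circ h$. The projection is the function $g:\mathbb{R}^2\to\mathbb{R}$, $g(x,y)=y$.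
   Formalization: In ''topologically equivalent to a projection'', k is a homeomorphism from the image of f onto the image of the projection, not of all of R; with k a homeomorphism of R the claim fails for f(x,y)=arctan y, and the two notions agree when f is onto. *)

(* Defs.v *)
From HB Require Import structures.
From mathcomp Require Import all_boot all_order all_algebra.
From mathcomp Require Import all_classical all_reals all_analysis.

Set Implicit Arguments.
Unset Strict Implicit.
Unset Printing Implicit Defensive.

Import Order.TTheory GRing.Theory Num.Theory.
Import numFieldNormedType.Exports.

Local Open Scope classical_set_scope.
Local Open Scope ring_scope.

(* [h] restricts to a homeomorphism of the subspace [A] onto the subspace [B];
   the values of the total functions outside [A] and [B] play no role, since
   [{within A, continuous h}] is continuity for the subspace topology of [A]. *)
Definition homeomorphism (X Y : topologicalType) (A : set X) (B : set Y)
    (h : X -> Y) : Prop :=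
  exists g : Y -> X,
    [/\ {homo h : x / A x >-> B x}, {homo g : y / B y >-> A y},
        (forall x, A x -> g (h x) = x), (forall y, B y -> h (g y) = y)
      & {within A, continuous h} /\ {within B, continuous g}].

Section Curves.
Variable R : realType.
Implicit Types (C U : set (R * R)) (F : set (set (R * R))).

Definition unit_interval : set R := `]0, 1[.

Definition curve C : Prop :=
  exists gamma : R -> R * R, homeomorphism unit_interval C gamma.

(* A partition is given by the set [F] of its blocks, whence the indexing by
   the identity. *)
Definition family_of_curves U F : Prop :=
  partition F id U /\ (forall C, F C -> curve C).

(* If [F] is a family of curves in [U], then [Up] is contained in [U], being
   the union of the images of the horizontal segments. *)
Definition regular_at F (p : R * R) : Prop :=
  exists Up : set (R * R), open_nbhs p Up /\
  exists psi : R * R -> R * R,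
    homeomorphism (unit_interval `*` unit_interval) Up psi /\
    forall y : R, unit_interval y ->
      exists2 C : set (R * R), F C & 
        psi @` (unit_interval `*` [set y]) = Up `&` C.

Definition regular_family_of_curves U F : Prop :=
  [/\ open U, family_of_curves U F & forall p, U p -> regular_at F p].

Definition level_sets (f : R * R -> R) : set (set (R * R)) :=
  [set f @^-1` [set c] | c in range f].

Definition open_interval (a b : \bar R) : set R :=
  [set y | (a < y%:E)%E && (y%:E < b)%E].

(* The change of variable [k] in the target is a homeomorphism between the
   images of [f] and [g], not of the whole line: a homeomorphism of the line
   could not carry a function with bounded image to one with image the line. If
   both functions are surjective, [k] is a homeomorphism of the line. *)
Definition topologically_equivalent (M : topologicalType) (f g : M -> R) :
    Prop :=
  exists h : M -> M, exists k : R -> R,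
    [/\ homeomorphism setT setT h, homeomorphism (range f) (range g) k
      & k \o f = g \o h].

Definition projection (p : R * R) : R := p.2.

End Curves.

(* Main.v *)
Require Import Defs.
From HB Require Import structures.
From mathcomp Require Import all_boot all_order all_algebra.
From mathcomp Require Import all_classical all_reals all_analysis.
From mathcomp Require Import ring lra.

Set Implicit Arguments.
Unset Strict Implicit.
Unset Printing Implicit Defensive.

Import Order.TTheory GRing.Theory Num.Theory.
Import numFieldNormedType.Exports.

Local Open Scope classical_set_scope.
Local Open Scope ring_scope.

(* Regularity makes [f] locally a projection, up to a reparametrization of the
   target, so there is a local section of [f] through every point and nearby
   points of a leaf (a level set) are joined by short leaf arcs. Since leaves
   are connected, this propagates along leaves: the arc of a leaf between [p]
   and [q] depends continuously on [p] and [q] for the Hausdorff distance.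
   Let [size_set] be a functional of compact sets that is continuous for that
   distance, strictly increasing for inclusion, and at least the norm of every
   element. Given two disjoint local sections [s0] and [s1], the size of the arc
   from [s0 (f p)] to [p], counted positively on the side of [s1], is a leaf
   coordinate: it is continuous, strictly monotone on leaves, and onto the line
   since a leaf leaves every compact set at both ends. Hence [f] is trivial over
   a neighbourhood of each value. Trivializations over adjacent segments can be
   glued, which gives a global trivialization once the image has been stretched
   to the whole line. *)

(** * Subspace continuity and relations on connected sets *)

Lemma within_nearP (T U : topologicalType) (A : set T) (f : T -> U) :
  {within A, continuous f} <->
  (forall x, A x -> forall W, nbhs (f x) W -> \forall y \near x, A y -> W (f y)).
Proof. exact: subspace_continuousP. Qed.

(** The class of [x] is open in [A], and so is its complement, being a union of classes. A nonempty
    part of a connected set that is both open and closed in it is the whole set. *)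
Lemma connected_equiv (T : topologicalType) (A : set T) (r : T -> T -> Prop) :
  connected A ->
  (forall x y, A x -> A y -> r x y -> r y x) ->
  (forall x y z, A x -> A y -> A z -> r x y -> r y z -> r x z) ->
  (forall x, A x -> \forall y \near x, A y -> r x y) ->
  forall x y, A x -> A y -> r x y.
Proof.
move=> cA rs rt rn x y Ax Ay.
suff AE : A `&` [set y | r x y] = A by move: Ay; rewrite -AE => -[].
apply: cA.
- by exists x; split=> //; exact: (nbhs_singleton (rn x Ax)).
(* The guard [A z ->] makes this interior an open set of [T] whose trace on [A] is the class of
   [x]. *)
- exists ([set z | A z -> r x z]°); first exact: open_interior.
  apply/seteqP; split=> z [Az].
    move=> rxz; split=> //.
    by near=> w => Aw; apply: (rt x z w) => //; move: Aw; near: w; exact: rn.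
  by move=> /interior_subset/(_ Az).
- exists (~` ([set z | A z -> ~ r x z]°)); first exact/open_closedC/open_interior.
  apply/seteqP; split=> z [Az].
    by move=> rxz; split=> // /interior_subset/(_ Az).
  move=> h; split=> //; apply: contrapT => nrxz; apply: h.
  near=> w => Aw rxw; apply: nrxz; apply: (rt x w z) => //; apply: rs => //.
  by move: Aw {rxw}; near: w; exact: rn.
Unshelve. all: by end_near. Qed.

(** * Betweenness of numbers, regardless of orientation *)

Section Betweenness.
Variable R : realDomainType.
Implicit Types a b c x : R.

Definition betw a b x : bool := (a <= x <= b) || (b <= x <= a).

Lemma betwC a b x : betw a b x = betw b a x.
Proof. by rewrite /betw orbC. Qed.

Lemma betwl a b : betw a b a.
Proof. by rewrite /betw !lexx /= andbT le_total. Qed.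

Lemma betwr a b : betw a b b.
Proof. by rewrite betwC betwl. Qed.

Lemma betwxx a x : betw a a x -> x = a.
Proof. by rewrite /betw orbb => h; apply/eqP; rewrite eq_le andbC. Qed.

Lemma betw_trans a b c x : betw a c x -> betw a b x || betw b c x.
Proof. by rewrite /betw; lra. Qed.

Lemma betw_sub a b c d x : betw a b c -> betw a b d -> betw c d x -> betw a b x.
Proof. by rewrite /betw; lra. Qed.

Lemma betwN a b x : betw (- a) (- b) (- x) = betw a b x.
Proof. by rewrite /betw; apply/idP/idP; lra. Qed.

Lemma betw3 a b c : ~~ betw b c a -> ~~ betw a b c -> betw a c b.
Proof. by rewrite /betw; lra. Qed.

Lemma betw_anti a b c : betw a b c -> betw c b a -> c = a.
Proof. by rewrite /betw => ? ?; apply/eqP; rewrite eq_le; lra. Qed.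

End Betweenness.

(** * Pairs and composites of maps continuous on subspaces *)

Lemma continuous_pair (T U V : topologicalType) (f : T -> U) (g : T -> V) x :
  {for x, continuous f} -> {for x, continuous g} ->
  {for x, continuous (fun y => (f y, g y))}.
Proof. by move=> cf cg; exact: cvg_pair cf cg. Qed.

Lemma within_comp (T U V : topologicalType) (A : set T) (B : set U)
    (f : T -> U) (g : U -> V) : {homo f : x / A x >-> B x} ->
  {within A, continuous f} -> {within B, continuous g} ->
  {within A, continuous (g \o f)}.
Proof.
move=> AB /within_nearP cf /within_nearP cg; apply/within_nearP => x Ax W gW.
apply: filterS (cf x Ax _ (cg (f x) (AB _ Ax) W gW)) => y h Ay.
by apply: h => //; exact: AB.
Qed.

Lemma within_pair (T U V : topologicalType) (A : set T) (f : T -> U) (g : T -> V) :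
  {within A, continuous f} -> {within A, continuous g} ->
  {within A, continuous (fun x => (f x, g x))}.
Proof. by move=> cf cg x; exact: cvg_pair (cf x) (cg x). Qed.

Lemma within_eq (T U : topologicalType) (A : set T) (f g : T -> U) :
  (forall x, A x -> f x = g x) ->
  {within A, continuous f} -> {within A, continuous g}.
Proof. by move=> fg; apply: subspace_eq_continuous => x /set_mem; exact: fg. Qed.

(** * Regular charts, local sections and short leaf segments *)

Section Charts.
Variables (R : realType) (f : R * R -> R).
Hypothesis f_cont : continuous f.
Local Notation I := (@unit_interval R).
Local Notation II := (I `*` I).

Lemma unit_square_open : open II.
Proof.
rewrite openE => -[x y] [Ix Iy].
by exists (I, I) => //; split; apply: open_nbhs_nbhs; split=> //; exact: interval_open.
Qed.

(** Each horizontal segment is sent onto the whole trace of one level set on [Up]. Two segments at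
    the same level would thus have the same image, against the injectivity of [psi]. *)
Lemma level_chart p : regular_at (level_sets f) p ->
  exists Up (psi g : R * R -> R * R),
    [/\ open Up /\ Up p,
        (forall x, II x -> Up (psi x) /\ g (psi x) = x),
        (forall q, Up q -> II (g q) /\ psi (g q) = q),
        {in II, continuous psi} /\ {in Up, continuous g}
      & forall x y, II x -> II y -> f (psi x) = f (psi y) <-> x.2 = y.2].
Proof.
move=> [Up [[oU Up_p] [psi [[g [psiU gI gK psiK [cpsi cg]]] lev]]]].
exists Up, psi, g; split => //.
- by move=> x Ix; split; [exact: psiU|exact: gK].
- by move=> q Uq; split; [exact: gI|exact: psiK].
- by rewrite -!continuous_open_subspace//; exact: unit_square_open.
(* The leaf attached to the ordinate of [x] is only known to exist; the point [psi x] on it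
   identifies its level as [c]. *)
have levE x c : II x -> f (psi x) = c ->
    psi @` (I `*` [set x.2]) = Up `&` f @^-1` [set c].
  move=> Ix fx; have [C [c' _ <-] Cx] := lev x.2 Ix.2.
  have : (psi @` (I `*` [set x.2])) (psi x) by exists x => //; split=> //; exact: Ix.1.
  by rewrite Cx => -[_ /=]; rewrite fx => <-.
move=> x y Ix Iy; split=> [fE|xyE].
- have xE := levE x _ Ix fE; have yE := levE y _ Iy erefl.
  have : (psi @` (I `*` [set y.2])) (psi x) by rewrite yE -xE; exists x => //; case: (Ix).
  case=> z [Iz1 /= z2] /(congr1 g); rewrite !gK//; first by move=> <-.
  by split=> //; rewrite z2; case: Iy.
- have : (psi @` (I `*` [set x.2])) (psi y) by exists y => //; split=> //; case: (Iy).
  by rewrite (levE x _ Ix erefl) => -[_ /=] ->.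
Qed.

(** On a vertical line of the chart, [f] is continuous and injective, hence has a continuous local
    inverse [k]. Lifting [k] back to that vertical line gives the section. *)
Lemma local_section p : regular_at (level_sets f) p ->
  exists s : R -> R * R, s (f p) = p /\
    \forall c \near f p, f (s c) = c /\ {for c, continuous s}.
Proof.
move=> /level_chart [Up [psi [g [[oU Up_p] psiU gU [cpsi cg] lev]]]].
have [Ip psip] := gU p Up_p.
case: (g p) Ip psip => a b [/= Ia Ib] psip.
pose h y := f (psi (a, y)).
have ch y : I y -> {for y, continuous h}.
  move=> Iy; apply: continuous_comp; last exact: f_cont.
  apply: (@continuous_comp _ _ _ (fun y => (a, y)) psi).
    by apply: continuous_pair; [exact: cvg_cst|exact: cvg_id].
  by apply: cpsi; rewrite inE; split.
pose k c := xget b [set y | I y /\ h y = c].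
have nearI : \forall y \near b, I y.
  by apply: open_nbhs_nbhs; split=> //; exact: interval_open.
have hK y : I y -> k (h y) = y.
  move=> Iy; rewrite /k; case: xgetP => [z _ [Iz hz]|/(_ y)]; last by case.
  exact: (proj1 (lev (a, z) (a, y) (conj Ia Iz) (conj Ia Iy))).
have [kc hkK] : {near h b, continuous k} /\ {near h b, cancel k h}.
  apply: near_can_continuousAcan_sym.
    by near=> y; apply: hK; near: y.
  by near=> y; apply: ch; near: y.
have hb : h b = f p by rewrite /h psip.
have cI : \forall c \near f p, I (k c).
  rewrite -hb; have := nbhs_singleton kc; rewrite /continuous_at hK//; exact.
exists (fun c => psi (a, k c)); split; first by rewrite -hb hK.
rewrite -hb in cI *; near=> c; split; first by near: c.
apply: (@continuous_comp _ _ _ (fun c => (a, k c)) psi).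
  by apply: continuous_pair; [exact: cvg_cst|near: c].
by apply: cpsi; rewrite inE; split=> //=; near: c.
Unshelve. all: by end_near. Qed.

(** In a chart, two points of equal level have the same ordinate, so a horizontal segment joins
    them; it is short when both points are close to [p]. *)
Lemma local_connected p (O : set (R * R)) : regular_at (level_sets f) p ->
  nbhs p O ->
  \forall q \near (p, p), f q.1 = f q.2 ->
    exists C, [/\ connected C, C `<=` O, C `<=` f @^-1` [set f q.1],
      C q.1 & C q.2].
Proof.
move=> /level_chart [Up [psi [g [[oU Up_p] psiU gU [cpsi cg] lev]]]] Op.
have [Ip psip] := gU p Up_p.
have : \forall x \near g p, II x /\ O (psi x).
  apply: filterI; first by apply: open_nbhs_nbhs; split=> //; exact: unit_square_open.
  by apply: cpsi; rewrite ?inE// psip.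
move=> /nbhs_ballP[e /= e0 He].
have : \forall q \near p, Up q /\ ball (g p) e (g q).
  apply: filterI; first exact: open_nbhs_nbhs.
  by apply: cg; [rewrite inE|exact: nbhsx_ballx].
move=> U'; near=> q => fq.
have [Uq1 B1] : Up q.1 /\ ball (g p) e (g q.1) by near: q; exact: (cvg_fst U').
have [Uq2 B2] : Up q.2 /\ ball (g p) e (g q.2) by near: q; exact: (cvg_snd U').
have [I1 K1] := gU _ Uq1; have [I2 K2] := gU _ Uq2.
have g2E : (g q.1).2 = (g q.2).2.
  by apply/(lev _ _ I1 I2); rewrite K1 K2.
(* Balls of the plane are squares, so the horizontal segment over [B] at the common ordinate stays
   in the ball around [g p]. *)
pose B := [set s | ball (g p).1 e s].
have Bsub s : B s -> II (s, (g q.1).2) /\ O (psi (s, (g q.1).2)).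
  by move=> Bs; apply: He; split=> //=; case: B1.
exists ((fun s => psi (s, (g q.1).2)) @` B); split.
- apply: connected_continuous_connected.
    apply/connected_intervalP; rewrite /B ball_itv; exact: interval_is_interval.
  apply: continuous_in_subspaceT => s; rewrite inE => Bs.
  apply: (@continuous_comp _ _ _ (fun s => (s, (g q.1).2)) psi).
    by apply: continuous_pair; [exact: cvg_id|exact: cvg_cst].
  by apply: cpsi; rewrite inE; case: (Bsub s Bs).
- by move=> _ [s /Bsub[_ +] <-].
- move=> _ [s /Bsub[Is _] <-] /=; rewrite -{2}K1.
  by apply/lev.
- by exists (g q.1).1; [case: B1|rewrite -surjective_pairing].
- by exists (g q.2).1; [case: B2|rewrite g2E -surjective_pairing].
Unshelve. all: by end_near. Qed.

End Charts.

(** * A size of compact sets of Whitney type *)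

Section SizeFunctional.
Variable R : realType.
Implicit Types (K : set (R * R)) (e : R) (phi : R * R -> R).

(** One half of Hausdorff closeness; the two directions are handled separately. *)
Definition within_dist e K K' := forall z, K z -> exists2 w, K' w & `|z - w| < e.

(** The 1-Lipschitz condition: exchanging [z] and [w] gives the other inequality. *)
Definition short_map phi := forall z w, phi z <= phi w + `|z - w|.

Lemma ball_dist (z w : R * R) e : ball z e w = (`|z - w| < e) :> Prop.
Proof. by rewrite -[ball _ _]/(ball z e) prod_norm_ball. Qed.

Lemma le_sup_image phi K z M : (forall w, K w -> phi w <= M) -> K z ->
  phi z <= sup (phi @` K).
Proof.
move=> KM Kz; apply: ub_le_sup; last by exists z.
by exists M => _ [w /KM ? <-].
Qed.

Lemma sup_image_le phi K M : K !=set0 -> (forall w, K w -> phi w <= M) ->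
  sup (phi @` K) <= M.
Proof.
move=> [z Kz] KM; apply: ge_sup; first by exists (phi z), z.
by move=> _ [w /KM ? <-].
Qed.

Lemma sup_image_within phi K K' M e : short_map phi -> K !=set0 ->
  (forall w, K' w -> phi w <= M) -> within_dist e K K' ->
  sup (phi @` K) <= sup (phi @` K') + e.
Proof.
move=> sphi K0 K'M KK'; apply: sup_image_le => // z /KK'[w Kw zw].
apply: le_trans (sphi z w) _; apply: lerD; last exact: ltW.
exact: (le_sup_image K'M Kw).
Qed.

Definition dense_point (n : nat) : R * R :=
  if @unpickle (rat * rat)%type n is Some q then (ratr q.1, ratr q.2) else 0.

Lemma dense_pointP (z : R * R) e : 0 < e -> exists n, `|z - dense_point n| < e.
Proof.
move=> e0.
have [a] : exists a : rat, ratr a \in `]z.1 - e, z.1 + e[ by apply: rat_in_itvoo; lra.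
have [b] : exists b : rat, ratr b \in `]z.2 - e, z.2 + e[ by apply: rat_in_itvoo; lra.
rewrite !in_itv /= => Hb Ha; exists (pickle (a, b)); rewrite /dense_point pickleK.
by rewrite prod_normE /= gt_max !ltr_distlC Ha Hb.
Qed.

Definition tent (n : nat) (q : R * R) : R := Num.max 0 (1 - `|q - dense_point n|).

Lemma tent_short n : short_map (tent n).
Proof.
move=> z w; rewrite /tent.
have := ler_distD z w (dense_point n); have := normr_ge0 (z - w); rewrite (distrC w z).
move=> ? ?.
by case: (leP 0 (1 - `|z - dense_point n|)) => ?;
   case: (leP 0 (1 - `|w - dense_point n|)) => ?; lra.
Qed.

Lemma tent_ge0 n q : 0 <= tent n q.
Proof. by rewrite le_max lexx. Qed.

Lemma tent_le1 n q : tent n q <= 1.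
Proof. by rewrite ge_max ler01 /= gerBl. Qed.

Definition tent_sum n K : R := \sum_(i < n) 2^-1 ^+ i.+1 * sup (tent i @` K).

Lemma geometric_half n : \sum_(i < n) 2^-1 ^+ i.+1 = 1 - 2^-1 ^+ n :> R.
Proof.
elim: n => [|n IH]; first by rewrite big_ord0 expr0 subrr.
by rewrite big_ord_recr /= IH exprS; field.
Qed.

Lemma tent_sum_within n K K' e : K !=set0 -> 0 <= e -> within_dist e K K' ->
  tent_sum n K <= tent_sum n K' + e.
Proof.
move=> K0 e0 KK'.
(* The weights of the first [n] tents add up to [1 - 2^-1 ^+ n], so only this fraction of [e] is
   consumed and the rest is nonnegative. *)
have -> : tent_sum n K' + e = tent_sum n K' + (1 - 2^-1 ^+ n) * e + 2^-1 ^+ n * e.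
  by ring.
apply: ler_wpDr; first by rewrite mulr_ge0// exprn_ge0.
rewrite -geometric_half mulr_suml -big_split /=; apply: ler_sum => i _.
rewrite -mulrDr; apply: ler_wpM2l; first by rewrite exprn_ge0.
apply: sup_image_within => //; first exact: tent_short.
by move=> w _; exact: (tent_le1 i).
Qed.

Lemma tent_sum_le1 n K : K !=set0 -> tent_sum n K <= 1.
Proof.
move=> K0; apply: (@le_trans _ _ (1 - 2^-1 ^+ n)); last by rewrite gerBl exprn_ge0.
rewrite -geometric_half; apply: ler_sum => i _.
rewrite ler_piMr ?exprn_ge0//; apply: sup_image_le => // w _; exact: tent_le1.
Qed.

Lemma sup_tent_ge0 n K : K !=set0 -> 0 <= sup (tent n @` K).
Proof.
move=> [z Kz]; apply: le_trans (tent_ge0 n z) _.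
by apply: (le_sup_image _ Kz) => w _; exact: tent_le1.
Qed.

Lemma tent_sum_nondecreasing K : K !=set0 ->
  {homo (fun n => tent_sum n K) : m n / (m <= n)%N >-> m <= n}.
Proof.
move=> K0; apply/nondecreasing_seqP => n.
rewrite /tent_sum big_ord_recr /= lerDl mulr_ge0 ?exprn_ge0//.
exact: sup_tent_ge0.
Qed.

(** The largest norm plus an unnormalized Whitney map. The supremum over [n] is the sum of a series
    with nonnegative terms; its tents, centred at a dense set, detect every proper enlargement of a
    compact set. *)
Definition size_set K : R :=
  sup ((fun q => `|q|) @` K) + sup (range (fun n => tent_sum n K)).

Lemma le_sup_tent_sum n K : K !=set0 ->
  tent_sum n K <= sup (range (fun n => tent_sum n K)).
Proof.
move=> K0; apply: ub_le_sup; last by exists n.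
by exists 1 => _ [m _ <-]; exact: tent_sum_le1.
Qed.

Lemma compact_norm_bounded K : compact K -> exists M, forall q, K q -> `|q| <= M.
Proof.
move=> cK; have [->|/set0P K0] := eqVneq K set0; first by exists 0.
have [_ [M MK]] : has_sup ((fun q => `|q|) @` K).
  apply: compact_has_sup; first by case: K0 => z Kz; exists `|z|, z.
  apply: continuous_compact => //; apply: continuous_subspaceT => x.
  exact: norm_continuous.
by exists M => q Kq; apply: MK; exists q.
Qed.

(** Each of the two summands of [size_set] grows by at most [e], whence the factor 2. *)
Lemma size_set_within K K' e : compact K' -> K !=set0 -> K' !=set0 -> 0 <= e ->
  within_dist e K K' -> size_set K <= size_set K' + 2 * e.
Proof.
move=> /compact_norm_bounded[M K'M] K0 K'0 e0 KK'.
have h1 : sup ((fun q => `|q|) @` K) <= sup ((fun q => `|q|) @` K') + e.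
  apply: sup_image_within K'M KK' => // z w.
  by rewrite -{1}(subrK w z) addrC ler_normD.
suff h2 : sup (range (fun n => tent_sum n K)) <=
    sup (range (fun n => tent_sum n K')) + e.
  by move: h1 h2; rewrite /size_set; lra.
apply: ge_sup; first by exists (tent_sum 0 K), 0%N.
move=> _ [n _ <-]; apply: le_trans (tent_sum_within n K0 e0 KK') _.
by rewrite lerD2r le_sup_tent_sum.
Qed.

Lemma norm_le_size_set K q : compact K -> K q -> `|q| <= size_set K.
Proof.
move=> /compact_norm_bounded[M KM] Kq.
have K0 : K !=set0 by exists q.
apply: ler_wpDr; last exact: (le_sup_image KM Kq).
by apply: le_trans (le_sup_tent_sum 0 K0); rewrite /tent_sum big_ord0.
Qed.

(** The point [z] is at positive distance from [K]. A tent centred very near [z] is close to 1 at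
    [z] and uniformly smaller on [K], so its term contributes a fixed gap to all later partial
    sums. *)
Lemma size_set_lt K K' z : K !=set0 -> closed K -> compact K' -> K `<=` K' ->
  K' z -> ~ K z -> size_set K < size_set K'.
Proof.
move=> K0 clK cK' KK' K'z nKz.
have K'0 : K' !=set0 by exists z.
have subK phi M : (forall w, K' w -> phi w <= M) ->
    sup (phi @` K) <= sup (phi @` K').
  by move=> K'M; apply: sup_image_le => // w /KK' K'w; exact: (le_sup_image K'M K'w).
have [M /subK normle] := compact_norm_bounded cK'.
suff : sup (range (fun n => tent_sum n K)) < sup (range (fun n => tent_sum n K')).
  by move: normle; rewrite /size_set; lra.
have [r r0 rK] : exists2 r, 0 < r & forall w, K w -> r <= `|z - w|.
  have : nbhs z (~` K) by apply: open_nbhs_nbhs; split=> //; exact: closed_openC.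
  move=> /nbhs_ballP[r /= r0 zr]; exists r => // w Kw.
  rewrite leNgt; apply/negP => zw; apply: (zr w) => //.
  by rewrite -/(ball z r w) ball_dist.
(* The cap at 1 keeps the bound [1 - 2 * d / 3] nonnegative, as a bound on a tent must be. *)
pose d := Num.min r 1.
have d0 : 0 < d by rewrite /d; case: (leP r 1) => //; rewrite ltr01.
have [dr d1] : d <= r /\ d <= 1 by rewrite /d; case: (leP r 1) => ?; lra.
have [m zm] : exists m, `|z - dense_point m| < d / 3 by apply: dense_pointP; lra.
have tlt : sup (tent m @` K) + d / 3 <= sup (tent m @` K').
  have : 1 - d / 3 <= sup (tent m @` K').
    apply: (@le_trans _ _ (tent m z)); first by rewrite le_max; apply/orP; right; lra.
    by apply: (le_sup_image _ K'z) => w _; exact: tent_le1.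
  suff : sup (tent m @` K) <= 1 - 2 * d / 3 by lra.
  apply: sup_image_le => // w Kw; rewrite ge_max; apply/andP; split; first lra.
  have := rK w Kw; have := ler_distD (dense_point m) z w.
  by rewrite (distrC w); lra.
pose d' := 2^-1 ^+ m.+1 * (d / 3).
have d'0 : 0 < d' by rewrite mulr_gt0 ?exprn_gt0//; lra.
have mono n : tent_sum n K <= tent_sum n K'.
  apply: ler_sum => i _; apply: ler_wpM2l; first by rewrite exprn_ge0.
  by apply: (subK _ 1) => w _; exact: tent_le1.
have step n : (m < n)%N -> tent_sum n K + d' <= tent_sum n K'.
  elim: n => // n IH; rewrite ltnS leq_eqVlt => /predU1P[<-|/IH{}IH].
    rewrite /tent_sum !big_ord_recr /= -addrA; apply: lerD; first exact: mono.
    by rewrite -mulrDr; apply: ler_wpM2l => //; rewrite exprn_ge0.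
  rewrite /tent_sum !big_ord_recr /= addrAC; apply: lerD; first exact: IH.
  apply: ler_wpM2l; first by rewrite exprn_ge0.
  by apply: (subK _ 1) => w _; exact: tent_le1.
suff : sup (range (fun n => tent_sum n K)) <=
    sup (range (fun n => tent_sum n K')) - d' by lra.
apply: ge_sup; first by exists (tent_sum 0 K), 0%N.
move=> _ [n _ <-]; rewrite lerBrDr.
(* Partial sums are nondecreasing, so the index may be raised beyond [m], where the gap [d'] is
   present. *)
apply: le_trans (le_sup_tent_sum (maxn n m.+1) K'0).
apply: le_trans (step _ (leq_maxr _ _)); rewrite lerD2r.
by apply: tent_sum_nondecreasing => //; exact: leq_maxl.
Qed.

End SizeFunctional.

(** * Gluing trivializations over intervals of values *)

Section Trivializations.
Variables (R : realType) (f : R * R -> R).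
Hypothesis f_cont : continuous f.

(** The map sending [p] to [(t p, f p)] is a homeomorphism of the part of the plane above [A] onto
    the product of the line and [A], with inverse [g]. *)
Definition trivialization (A : set R) (t : R * R -> R) (g : R * R -> R * R) :=
  [/\ forall w c, A c -> f (g (w, c)) = c /\ t (g (w, c)) = w,
      forall p, A (f p) -> g (t p, f p) = p,
      {within f @^-1` A, continuous t} & {within setT `*` A, continuous g}].

Lemma trivialization_sub A B t g : A `<=` B ->
  trivialization B t g -> trivialization A t g.
Proof.
move=> AB [fg gt ct cg]; split=> [w c /AB|p /AB||].
- exact: fg.
- exact: gt.
- by apply: continuous_subspaceW ct => p /= /AB.
- by apply: continuous_subspaceW cg => -[w c] /= [? /AB].
Qed.

(* The new chart sends the fibre over [c] to the fibre over [rho c] along the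
   trivialization over [B], then uses the trivialization over [A]. *)
Lemma trivialization_extend A B t g t' g' (rho : R -> R) :
  trivialization A t g -> trivialization B t' g' -> A `<=` B -> continuous rho ->
  (forall c, A (rho c)) -> (forall c, A c -> rho c = c) ->
  trivialization B
    (fun p => t (g' (t' p, rho (f p)))) (fun x => g' (t' (g (x.1, rho x.2)), x.2)).
Proof.
move=> [fg gt ct cg] [fg' gt' ct' cg'] AB crho Arho rhoE.
have Brho c : B (rho c) by exact: AB.
split=> /=.
- move=> w c Bc; have [fgw tgw] := fg w _ (Arho c).
  have Bf : B (f (g (w, rho c))) by rewrite fgw.
  have [-> ->] := fg' (t' (g (w, rho c))) _ Bc; split=> //.
  by rewrite -{2}fgw gt'.
- move=> p Bp; have [fgw tgw] := fg' (t' p) _ (Brho (f p)).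
  have := gt (g' (t' p, rho (f p))); rewrite fgw => /(_ (Arho _)) ->.
  by rewrite tgw gt'.
- apply: (within_comp (f := fun p => g' (t' p, rho (f p)))) ct.
    by move=> p Bp /=; have [-> _] := fg' (t' p) _ (Brho (f p)).
  apply: (within_comp (f := fun p => (t' p, rho (f p)))) cg'.
    by move=> q _; split=> //; exact: Brho.
  apply: within_pair => //; apply: continuous_subspaceT => x.
  by apply: continuous_comp; [exact: f_cont|exact: crho].
- apply: (within_comp (f := fun x : R * R => (t' (g (x.1, rho x.2)), x.2))) cg'.
    by move=> x [_ ?].
  apply: within_pair; last by apply: continuous_subspaceT => x; exact: cvg_snd.
  apply: (within_comp (f := fun x : R * R => g (x.1, rho x.2))) ct'.
    by move=> x _ /=; have [-> _] := fg x.1 _ (Arho x.2).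
  apply: (within_comp (f := fun x : R * R => (x.1, rho x.2))) cg.
    by move=> q _; split=> //; exact: Arho.
  apply: continuous_subspaceT => x; apply: continuous_pair; first exact: cvg_fst.
  by apply: (@continuous_comp _ _ _ snd rho); [exact: cvg_snd|exact: crho].
Qed.

(** The chart over [[x, y]] is kept. Above [[y, z]], a point is pushed along the second chart to the
    fibre over [y], where the first chart reads its coordinate. *)
Lemma trivialization_cat x y z t g t' g' : x <= y -> y <= z ->
  trivialization `[x, y] t g -> trivialization `[y, z] t' g' ->
  exists t'' g'', trivialization `[x, z] t'' g''.
Proof.
move=> xy yz [fg gt ct cg] [fg' gt' ct' cg'].
have Ay : `[x, y]%classic y by rewrite /= in_itv /= xy lexx.
have By : `[y, z]%classic y by rewrite /= in_itv /= yz lexx.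
have split_itv : `[x, z]%classic = `[x, y]%classic `|` `[y, z]%classic.
  by apply/seteqP; split=> c /=; rewrite !in_itv /=; [case: (leP c y)|]; lra.
exists (fun p => if f p <= y then t p else t (g' (t' p, y))),
       (fun x => if x.2 <= y then g x else g' (t' (g (x.1, y)), x.2)).
have leP_itv c : `[x, z]%classic c -> c <= y /\ `[x, y]%classic c \/
    y < c /\ `[y, z]%classic c.
  by rewrite /= !in_itv /=; case: (leP c y) => ? ?; [left|right]; split=> //; lra.
(* The two formulas agree on the fibre over [y], so continuity can be checked separately above the
   two closed segments. *)
have [tE gE] : (forall p, f p = y -> t (g' (t' p, y)) = t p) /\
    (forall w, g' (t' (g (w, y)), y) = g (w, y)).
  split=> [p fp|w]; first by rewrite -fp gt'// fp.
  by have [fgy _] := fg w _ Ay; rewrite -{2}fgy gt'// fgy.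
split.
- move=> w c /leP_itv[[cy Ac]|[yc Bc]] /=.
    by rewrite cy; have [-> ->] := fg w c Ac; rewrite cy.
  rewrite leNgt yc /=.
  have [-> ->] := fg' (t' (g (w, y))) c Bc; rewrite leNgt yc /=; split=> //.
  by rewrite gE; have [_ ->] := fg w _ Ay.
- move=> p /leP_itv[[py Ap]|[yp Bp]] /=; first by rewrite py gt.
  rewrite leNgt yp /=; have [fgy tgy] := fg' (t' p) _ By.
  by rewrite -{2}fgy gt ?fgy// tgy gt'.
- rewrite split_itv preimage_setU; apply: withinU_continuous.
  + by apply: preimage_closed => //; exact: interval_closed.
  + by apply: preimage_closed => //; exact: interval_closed.
  + by apply: within_eq ct => p /=; rewrite in_itv /= => /andP[_ ->].
  + have : {within f @^-1` `[y, z], continuous (fun p => t (g' (t' p, y)))}.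
      apply: (within_comp (f := fun p => g' (t' p, y))) ct.
        by move=> p _ /=; have [-> _] := fg' (t' p) _ By.
      apply: (within_comp (f := fun p => (t' p, y))) cg'; first by move=> q _; split.
      by apply: within_pair => //; apply: continuous_subspaceT => q; exact: cvg_cst.
    apply: within_eq => p /=; rewrite in_itv /= => /andP[yp _].
    by case: ifPn => // py; rewrite tE//; apply/eqP; rewrite eq_le py.
- have -> : setT `*` `[x, z]%classic = (setT `*` `[x, y]%classic) `|`
      (setT `*` `[y, z]%classic) :> set (R * R).
    rewrite split_itv; apply/seteqP; split=> -[a b] /=; tauto.
  have cl (a b : R) : closed (setT `*` `[a, b]%classic : set (R * R)).
    have -> : setT `*` `[a, b]%classic = snd @^-1` `[a, b]%classic :> set (R * R).
      by apply/seteqP; split=> -[? ?] //= [].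
    by apply: preimage_closed; [move=> q _; exact: cvg_snd|exact: interval_closed].
  apply: withinU_continuous => //.
  + by apply: within_eq cg => -[w c] /= [_]; rewrite in_itv /= => /andP[_ ->].
  + have : {within setT `*` `[y, z]%classic, continuous
        (fun x => g' (t' (g (x.1, y)), x.2))}.
      apply: (within_comp (f := fun x : R * R => (t' (g (x.1, y)), x.2))) cg'.
        by move=> q [].
      apply: within_pair; last by apply: continuous_subspaceT => q; exact: cvg_snd.
      apply: (within_comp (f := fun x : R * R => g (x.1, y))) ct'.
        by move=> q _ /=; have [-> _] := fg q.1 _ Ay.
      apply: (within_comp (f := fun x : R * R => (x.1, y))) cg.
        by move=> q _; split.
      apply: continuous_subspaceT => q.
      by apply: continuous_pair; [exact: cvg_fst|exact: cvg_cst].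
    apply: within_eq => -[w c] /= [_]; rewrite in_itv /= => /andP[yc _].
    by case: ifPn => // cy; have -> : c = y by apply/eqP; rewrite eq_le cy.
Qed.

(** Having a trivialization over the segment between two values is a symmetric relation, transitive
    by gluing or restriction, and it holds between nearby values; the line is connected. *)
Lemma trivialization_segment :
  (forall c, exists2 d, 0 < d & exists t g, trivialization `[c - d, c + d] t g) ->
  forall x y, x <= y -> exists t g, trivialization `[x, y] t g.
Proof.
move=> loc x y xy.
pose r x y := exists t g, trivialization `[Num.min x y, Num.max x y] t g.
suff : r x y by rewrite /r (min_idPl xy) (max_idPr xy).
have sub (a b a' b' : R) : a' <= a -> b <= b' ->
    (exists t g, trivialization `[a', b'] t g) -> exists t g, trivialization `[a, b] t g.
  move=> aa bb [t [g tg]]; exists t, g; apply: trivialization_sub tg => c /=.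
  by rewrite !in_itv /=; lra.
have cat (a b c : R) : a <= b -> b <= c -> (exists t g, trivialization `[a, b] t g) ->
    (exists t g, trivialization `[b, c] t g) -> exists t g, trivialization `[a, c] t g.
  by move=> ab bc [t [g tg]] [t' [g' tg']]; exact: trivialization_cat tg tg'.
apply: (@connected_equiv _ setT r) => //.
- by apply/connected_intervalP.
- by move=> a b _ _; rewrite /r minC maxC.
- move=> a b c _ _ _; rewrite /r.
  case: (leP a b) => ab; case: (leP b c) => bc; case: (leP a c) => ac h1 h2;
    try by exfalso; lra.
  + exact: cat h1 h2.
  + by apply: sub h1; lra.
  + by apply: sub h2; lra.
  + by apply: sub h2; lra.
  + by apply: sub h1; lra.
  + by apply: cat h2 h1; lra.
- move=> a _; have [d d0 tg] := loc a.
  have : nbhs a (ball a d) by exact: nbhsx_ballx.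
  apply: filterS => b; rewrite -ball_normE /= ltr_distlC => /andP[db bd] _.
  apply: sub tg; first by rewrite le_min; lra.
  by rewrite ge_max; lra.
Qed.

Lemma clamp_continuous (b : R) :
  continuous (fun c : R => Num.max (- b) (Num.min b c)).
Proof.
move=> c.
apply: (@continuous_max R R (cst (- b)) (fun c => Num.min b c) c).
  exact: cvg_cst.
by apply: (@continuous_min R R (cst b) id c); [exact: cvg_cst|exact: cvg_id].
Qed.

(** The charts over the segments [[- n, n]] are corrected one after the other so that each extends
    the previous one. A point is then read in any chart whose segment contains its level. *)
Lemma trivialization_setT :
  (forall n : nat, exists t g, trivialization `[- n%:R, n%:R] t g) ->
  exists (t : R * R -> R) (g : R * R -> R * R), [/\ continuous t, continuous g,
    forall x, f (g x) = x.2 /\ t (g x) = x.1 & forall p, g (t p, f p) = p].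
Proof.
move=> segP.
have {}segP n : exists T : (R * R -> R) * (R * R -> R * R),
    trivialization `[- n%:R, n%:R] T.1 T.2.
  by have [t [g tg]] := segP n; exists (t, g).
have [T TP] := choice segP.
(* The retraction of the line onto [[- n, n]], as required to extend a chart. *)
pose rho (n : nat) (c : R) : R := Num.max (- n%:R) (Num.min n%:R c).
pose step n (E : (R * R -> R) * (R * R -> R * R)) :=
  (fun p => E.1 ((T n.+1).2 ((T n.+1).1 p, rho n (f p))),
   fun x : R * R => (T n.+1).2 ((T n.+1).1 (E.2 (x.1, rho n x.2)), x.2)).
pose E := fix E n := if n is m.+1 then step m (E m) else T 0%N.
have inI n (c : R) : `[- n%:R, n%:R]%classic c = (`|c| <= n%:R) :> Prop.
  by rewrite /= in_itv /= ler_norml.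
have rhoI n (c : R) : `[- n%:R, n%:R]%classic (rho n c).
  have n0 : 0 <= n%:R :> R by [].
  rewrite /rho /= in_itv /= le_max lexx /= ge_max ge_min lexx andbT.
  by apply: (le_trans _ n0); rewrite oppr_le0.
have rhoE n (c : R) : `[- n%:R, n%:R]%classic c -> rho n c = c.
  by rewrite /= in_itv /= => /andP[? ?]; rewrite /rho min_r// max_r.
have leI n m : (n <= m)%N ->
    (`[- n%:R, n%:R]%classic : set R) `<=` `[- m%:R, m%:R]%classic.
  by move=> nm c; rewrite !inI => /le_trans; apply; rewrite ler_nat.
have EP n : trivialization `[- n%:R, n%:R] (E n).1 (E n).2.
  elim: n => [|n IH]; first exact: TP.
  apply: (trivialization_extend IH (TP n.+1)) => //; first exact: leI.
    exact: clamp_continuous.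
  exact: rhoE.
have Estep n : (forall w c, `|c| <= n%:R -> (E n.+1).2 (w, c) = (E n).2 (w, c)) /\
    (forall p, `|f p| <= n%:R -> (E n.+1).1 p = (E n).1 p).
  have [fT tT _ _] := TP n.+1; have [fE tE _ _] := EP n.
  have nn : (n <= n.+1)%N by [].
  split=> [w c|p] /=; rewrite -inI => cn.
    have [fEc _] := fE w c cn.
    by rewrite rhoE// -{2}fEc tT// fEc; exact: leI cn.
  by rewrite rhoE// tT//; exact: leI cn.
have Ele n m : (n <= m)%N ->
    (forall w c, `|c| <= n%:R -> (E m).2 (w, c) = (E n).2 (w, c)) /\
    (forall p, `|f p| <= n%:R -> (E m).1 p = (E n).1 p).
  move=> /subnK <-; elim: (m - n)%N => [//|k [IHg IHt]].
  have kn (x : R) : x <= n%:R -> x <= (k + n)%:R.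
    by move=> /le_trans; apply; rewrite ler_nat leq_addl.
  have [sg st] := Estep (k + n)%N.
  split=> [w c cn|p pn]; first by rewrite addSn sg ?IHg//; exact: kn.
  by rewrite addSn st ?IHt//; exact: kn.
have Eeq n m : (forall w c, `|c| <= n%:R -> `|c| <= m%:R ->
      (E m).2 (w, c) = (E n).2 (w, c)) /\
    (forall p, `|f p| <= n%:R -> `|f p| <= m%:R -> (E m).1 p = (E n).1 p).
  have [nm|/ltnW mn] := leqP n m.
    by have [? ?] := Ele _ _ nm; split=> *; eauto.
  by have [hg ht] := Ele _ _ mn; split=> *; [rewrite hg|rewrite ht].
(* The bound is strict, so the chart of index [N (f p)] serves a whole neighbourhood of [p]; there
   [Eeq] replaces the varying index by this fixed one. *)
pose N (c : R) := Num.bound `|c|.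
have NP c : `|c| < (N c)%:R by exact: archi_boundP.
have near_lt (X : topologicalType) (x : X) (h : X -> R) n : {for x, continuous h} ->
    `|h x| < n%:R -> \forall y \near x, `|h y| < n%:R.
  move=> ch hx; have : (fun y => `|h y|) @ x --> `|h x| by exact: cvg_norm ch.
  by move=> /cvgr_lt; exact.
exists (fun p => (E (N (f p))).1 p), (fun x => (E (N x.2)).2 x); split.
- move=> p; have [_ _ /within_nearP ct _] := EP (N (f p)).
  have fpN : `[- (N (f p))%:R, (N (f p))%:R]%classic (f p) by rewrite inI ltW.
  move=> W /(ct p fpN) nW; suff : \forall q \near p, W ((E (N (f q))).1 q) by [].
  apply: filterS2 nW (near_lt _ p f _ (@f_cont p) (NP (f p))) => q Wq fq.
  rewrite (proj2 (Eeq (N (f p)) (N (f q))) q (ltW fq) (ltW (NP (f q)))).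
  have fqN : `[- (N (f p))%:R, (N (f p))%:R]%classic (f q) by rewrite inI ltW.
  exact: (Wq fqN).
- move=> x; have [_ _ _ /within_nearP cg] := EP (N x.2).
  have xN : (setT `*` `[- (N x.2)%:R, (N x.2)%:R]%classic) x.
    by split=> //; rewrite inI ltW.
  move=> W /(cg x xN) nW; suff : \forall y \near x, W ((E (N y.2)).2 y) by [].
  apply: filterS2 nW (near_lt _ x snd _ (@cvg_snd _ _ _ _ _) (NP x.2)) => -[w c] Wy yN.
  have {}yN : `|c| < (N x.2)%:R by exact: yN.
  suff : W ((E (N c)).2 (w, c)) by [].
  rewrite (proj1 (Eeq (N x.2) (N c)) w c (ltW yN) (ltW (NP c))).
  have cN : `[- (N x.2)%:R, (N x.2)%:R]%classic c by rewrite inI ltW.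
  exact: (Wy (conj I cN)).
- move=> [w c]; have [fg _ _ _] := EP (N c).
  have cN : `[- (N c)%:R, (N c)%:R]%classic c by rewrite inI ltW.
  have [fE tE] := fg w c cN; split; first exact: fE.
  suff : (E (N (f ((E (N c)).2 (w, c))))).1 ((E (N c)).2 (w, c)) = w by [].
  by rewrite fE.
- move=> p; have [_ gt _ _] := EP (N (f p)).
  have fpN : `[- (N (f p))%:R, (N (f p))%:R]%classic (f p) by rewrite inI ltW.
  exact: (gt p fpN).
Qed.

End Trivializations.

(** * Leaves and their arcs *)

(* [gam c] parametrizes the leaf of value [c] and [u] inverts all the [gam c];
   nothing relates the parametrizations of different leaves. *)
Section Leaves.
Variables (R : realType) (f : R * R -> R).
Local Notation I := (@unit_interval R).
Hypothesis f_cont : continuous f.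
Hypothesis reg : forall p, regular_at (level_sets f) p.
Variables (gam : R -> R -> R * R) (u : R * R -> R).
Hypothesis gamK : forall c x, I x -> f (gam c x) = c /\ u (gam c x) = x.
Hypothesis uK : forall p, I (u p) /\ gam (f p) (u p) = p.
Hypothesis gam_cont : forall c, {within I, continuous (gam c)}.
Hypothesis u_cont : forall c, {within f @^-1` [set c], continuous u}.

Definition arc p q : set (R * R) := [set z | f z = f p /\ betw (u p) (u q) (u z)].

Lemma leaf_inj p q : f p = f q -> u p = u q -> p = q.
Proof. by move=> fE uE; rewrite -(uK p).2 -(uK q).2 fE uE. Qed.

Lemma arcC p q : f p = f q -> arc p q = arc q p.
Proof.
move=> fE; apply/seteqP; split=> z [/= fz]; rewrite betwC => ?;
  by split=> //=; congruence.
Qed.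

Lemma arcl p q : arc p q p.
Proof. by split=> //; rewrite betwl. Qed.

Lemma arcr p q : f p = f q -> arc p q q.
Proof. by split=> //; rewrite betwr. Qed.

Lemma arcxx p : arc p p = [set p].
Proof.
apply/seteqP; split=> [z [fz /betwxx]|_ ->]; last exact: arcl.
exact: leaf_inj.
Qed.

Lemma arc_trans q p r : f p = f q -> arc p r `<=` arc p q `|` arc q r.
Proof.
move=> fE z [fz /(betw_trans (u q))/orP[]b]; [by left|right].
by split=> //; rewrite fz.
Qed.

Lemma arc_sub p q r s : arc p q r -> arc p q s -> arc r s `<=` arc p q.
Proof.
move=> [fr br] [fs bs] z [fz bz]; split; first by rewrite fz.
exact: betw_sub br bs bz.
Qed.

Lemma arcE p q : arc p q = gam (f p) @` [set x | betw (u p) (u q) x].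
Proof.
apply/seteqP; split=> [z [fz bz]|_ [x /= bx <-]].
  by exists (u z) => //; rewrite -fz (uK z).2.
have Ix : I x.
  have := (uK p).1; have := (uK q).1; move: bx.
  by rewrite /unit_interval /= !in_itv /= /betw; lra.
by have [fx ux] := gamK (f p) Ix; split=> //; rewrite ux.
Qed.

Lemma betw_set (a b : R) :
  [set x | betw a b x] = `[Num.min a b, Num.max a b]%classic.
Proof.
apply/seteqP; split=> x /=; rewrite in_itv /= /betw;
  by case: (leP a b) => ?; lra.
Qed.

Lemma betw_unit p q : [set x | betw (u p) (u q) x] `<=` I.
Proof.
move=> x /=; have := (uK p).1; have := (uK q).1.
by rewrite /unit_interval /= !in_itv /= /betw; lra.
Qed.

Lemma arc_connected p q : connected (arc p q).
Proof.
rewrite arcE; apply: connected_continuous_connected.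
  by rewrite betw_set; exact: segment_connected.
exact: (continuous_subspaceW (@betw_unit p q) (@gam_cont _)).
Qed.

Lemma arc_compact p q : compact (arc p q).
Proof.
rewrite arcE; apply: continuous_compact.
  exact: (continuous_subspaceW (@betw_unit p q) (@gam_cont _)).
by rewrite betw_set; exact: segment_compact.
Qed.

Lemma arc_closed p q : closed (arc p q).
Proof. by apply: compact_closed; [exact: norm_hausdorff|exact: arc_compact]. Qed.

(** The image of [C] under [u] is an interval and [u] is injective on a leaf. Thus an arc is the
    least connected part of its leaf containing both ends, whatever the parametrization. *)
Lemma arc_connected_sub p q (C : set (R * R)) : connected C ->
  C `<=` f @^-1` [set f p] -> C p -> C q -> arc p q `<=` C.
Proof.
move=> cC Cf Cp Cq z [fz bz].
have /connected_intervalP iC : connected (u @` C).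
  apply: connected_continuous_connected => //.
  exact: (continuous_subspaceW Cf (@u_cont _)).
have [w Cw uw] : (u @` C) (u z).
  have up : (u @` C) (u p) by exists p.
  have uq : (u @` C) (u q) by exists q.
  by case/orP: bz => bz; [exact: iC up uq _ bz|exact: iC uq up _ bz].
by rewrite -(@leaf_inj w z)// fz; exact: Cf.
Qed.

Lemma arc_small (p : R * R) (O : set (R * R)) : nbhs p O ->
  \forall q \near (p, p), f q.1 = f q.2 -> arc q.1 q.2 `<=` O.
Proof.
move=> /(local_connected (reg p)); apply: filterS => q h fE.
have [C [cC CO Cf C1 C2]] := h fE.
exact: subset_trans (arc_connected_sub cC Cf C1 C2) CO.
Qed.

(** * Hausdorff continuity of an arc in its ends *)

Definition arc_near (O : set (R * R)) (p q : R * R) : Prop :=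
  \forall r \near (p, q), f r.1 = f r.2 -> arc r.1 r.2 `<=` O.

Lemma arc_nearC O p q : arc_near O p q -> arc_near O q p.
Proof.
move=> [[/= U V] [/= Up Vq] UV]; exists (V, U) => //= -[r s] [/= Vr Us] fE.
by rewrite arcC//; exact: (UV (s, r)).
Qed.

(** A local section through [q] supplies, on each nearby leaf, a point close to [q] that cuts the
    arc into two pieces, each controlled by one hypothesis. *)
Lemma arc_near_trans O p q r : f p = f q -> f q = f r ->
  arc_near O p q -> arc_near O q r -> arc_near O p r.
Proof.
move=> pq qr [[/= U V] [/= Up Vq] UV] [[/= U' V'] [/= Uq Vr] UV'].
have [s [sq ns]] := local_section f_cont (reg q).
have : \forall c \near f q, f (s c) = c /\ (V `&` U') (s c).
  near=> c.
  have [fsc _] : f (s c) = c /\ {for c, continuous s} by near: c.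
  split=> //; near: c; have [_ cs] := nbhs_singleton ns.
  by apply: cs; rewrite sq; exact: filterI.
rewrite -{1}pq => nV.
exists (U `&` [set p | f (s (f p)) = f p /\ (V `&` U') (s (f p))], V').
  by split=> //=; apply: filterI => //; exact: (f_cont nV).
move=> [p' r'] [[/= Up' [fs [Vs Us]]] Vr'] fE.
apply: subset_trans (@arc_trans (s (f p')) _ _ _) _; first by rewrite fs.
rewrite subUset; split; first by apply: (UV (p', s (f p'))).
by apply: (UV' (s (f p'), r')) => //=; rewrite fs.
Unshelve. all: by end_near. Qed.

(* On [arc p q], [arc_near O] is an equivalence relation with open classes. *)
Lemma arc_upper (O : set (R * R)) p q : f p = f q -> open O ->
  arc p q `<=` O -> arc_near O p q.
Proof.
move=> fE oO sO.
apply: (connected_equiv (@arc_connected p q)) => [x y ? ?|x y z|||].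
- exact: arc_nearC.
- by move=> [fx _] [fy _] [fz _]; apply: arc_near_trans; congruence.
- move=> x Ax; have Ox : nbhs x O by apply: open_nbhs_nbhs; split=> //; exact: sO.
  have [[/= U V] [/= Ux Vx] UV] := arc_small Ox.
  have : nbhs x (U `&` V) by exact: filterI.
  rewrite nbhsE => -[W [oW Wx] WUV]; apply: filterS (open_nbhs_nbhs (conj oW Wx)).
  move=> y Wy _; exists (W, W).
    by split; apply: open_nbhs_nbhs.
  by move=> [r s] [/= Wr Ws]; apply: (UV (r, s)); split; [case: (WUV r)|case: (WUV s)].
- exact: arcl.
- exact: arcr.
Qed.


Lemma arc_upper_cvg {X : Type} {F : set_system X} {FF : Filter F}
    (P Q : X -> R * R) p q O : P @ F --> p -> Q @ F --> q ->
  f p = f q -> (\forall x \near F, f (P x) = f (Q x)) ->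
  open O -> arc p q `<=` O -> \forall x \near F, arc (P x) (Q x) `<=` O.
Proof.
move=> Pp Qq pq PQ oO sO.
have PQO : \forall x \near F, f (P x) = f (Q x) -> arc (P x) (Q x) `<=` O.
  exact: (cvg_pair Pp Qq (arc_upper pq oO sO)).
by apply: (filterS2 FF _ PQ PQO) => x fx; exact.
Qed.

(** A closed neighbourhood of [z] misses the closed arc. By upper semicontinuity nearby arcs miss it
    too, while [Z x] enters it. *)
Lemma arc_avoid_cvg {X : Type} {F : set_system X} {FF : Filter F}
    (P Q Z : X -> R * R) p q z : P @ F --> p -> Q @ F --> q -> Z @ F --> z ->
  f p = f q -> (\forall x \near F, f (P x) = f (Q x)) ->
  ~ arc p q z -> \forall x \near F, ~ arc (P x) (Q x) (Z x).
Proof.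
move=> Pp Qq Zz pq PQ npqz.
have [B [cB Bz sB]] : exists B, [/\ closed B, nbhs z B & B `<=` ~` arc p q].
  have : nbhs z (~` arc p q).
    by apply: open_nbhs_nbhs; split=> //; apply: closed_openC; exact: arc_closed.
  move=> /nbhs_closedballP[r zr]; exists (closed_ball z r%:num); split=> //.
    exact: closed_ball_closed.
  by apply/nbhs_closedballP; exists r.
have sO : arc p q `<=` ~` B by move=> w Aw /sB.
apply: (filterS2 FF _ (Zz _ Bz) (arc_upper_cvg Pp Qq pq PQ (closed_openC cB) sO)).
by move=> x Bx sx /sx.
Qed.

(* Among three points of a leaf, the one that is not between the two others is
   recognized by avoidance of an arc, which is an open condition. *)
Lemma arc_mid_cvg {X : Type} {F : set_system X} {FF : Filter F}
    (P Q Z : X -> R * R) p q z : P @ F --> p -> Q @ F --> q -> Z @ F --> z ->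
  f p = f q -> (\forall x \near F, f (P x) = f (Q x)) ->
  (\forall x \near F, f (P x) = f (Z x)) ->
  arc p q z -> z <> p -> z <> q ->
  \forall x \near F, [/\ arc (P x) (Q x) (Z x), Z x <> P x & Z x <> Q x].
Proof.
move=> Pp Qq Zz pq PQ PZ [fz bz] zp zq.
have np : ~ arc z q p.
  by move=> [_ /(betw_anti bz)/(leaf_inj fz)].
have nq : ~ arc p z q.
  move=> [_]; rewrite betwC => b.
  apply: zq; apply: leaf_inj; first by rewrite fz.
  by apply: betw_anti b; rewrite betwC.
have ZQ : \forall x \near F, f (Z x) = f (Q x).
  by apply: (filterS2 FF _ PQ PZ) => x <- <-.
have nP := arc_avoid_cvg (FF := FF) Zz Qq Pp (etrans fz pq) ZQ np.
have nQ := arc_avoid_cvg (FF := FF) Pp Zz Qq (esym fz) PZ nq.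
have nPQ : \forall x \near F, ~ arc (Z x) (Q x) (P x) /\ ~ arc (P x) (Z x) (Q x).
  exact: filterI.
apply: (filterS3 FF _ PQ PZ nPQ) => x fPQ fPZ [nPx nQx].
split.
- split=> //; apply: betw3; apply/negP => b; [apply: nPx|apply: nQx];
    by split=> //; congruence.
- by move=> ZP; apply: nPx; rewrite ZP; exact: arcl.
- by move=> ZQx; apply: nQx; rewrite ZQx; exact: arcr.
Qed.

Lemma section_cvg {X : Type} {F : set_system X} {FF : Filter F}
    (P : X -> R * R) (p z : R * R) : P @ F --> p -> f p = f z ->
  exists Z : X -> R * R, Z @ F --> z /\ \forall x \near F, f (Z x) = f (P x).
Proof.
move=> Pp pz; have [s [sz ns]] := local_section f_cont (reg z).
have fP : f \o P @ F --> f z by rewrite -pz; apply: (cvg_comp _ _ Pp); exact: f_cont.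
exists (fun x => s (f (P x))); split; last first.
  by apply: (@filterS _ _ FF _ _ _ (fP _ ns)) => x [].
have [_ cs] := nbhs_singleton ns.
by apply: (cvg_comp _ _ fP); rewrite -{2}sz; exact: cs.
Qed.

(** A local section carries [z] to the nearby leaves, where it stays between the ends by
    [arc_mid_cvg]. The cases where [z] is an end are settled by the ends themselves. *)
Lemma arc_lower_cvg {X : Type} {F : set_system X} {FF : Filter F}
    (P Q : X -> R * R) p q z O : P @ F --> p -> Q @ F --> q ->
  f p = f q -> (\forall x \near F, f (P x) = f (Q x)) ->
  arc p q z -> nbhs z O ->
  \forall x \near F, exists2 w, arc (P x) (Q x) w & O w.
Proof.
move=> Pp Qq pq PQ Az Oz.
have [zp|zp] := pselect (z = p).
  rewrite zp in Oz.
  by apply: (@filterS _ _ FF _ _ _ (Pp _ Oz)) => x Ox; exists (P x) => //; exact: arcl.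
have [zq|zq] := pselect (z = q).
  rewrite zq in Oz.
  by apply: (filterS2 FF _ PQ (Qq _ Oz)) => x fx Ox; exists (Q x) => //; exact: arcr.
have [Z [Zz ZP]] := section_cvg Pp (esym Az.1).
have PZ : \forall x \near F, f (P x) = f (Z x) by apply: (@filterS _ _ FF _ _ _ ZP).
apply: (filterS2 FF _ (arc_mid_cvg Pp Qq Zz pq PQ PZ Az zp zq) (Zz _ Oz)).
by move=> x [? _ _] ?; exists (Z x).
Qed.

(** One direction is upper semicontinuity for the open [e]-neighbourhood of the arc; the other is
    lower semicontinuity, made uniform by compactness of the arc. *)
Lemma arc_within_cvg {X : Type} {F : set_system X} {FF : Filter F}
    (P Q : X -> R * R) p q e : P @ F --> p -> Q @ F --> q ->
  f p = f q -> (\forall x \near F, f (P x) = f (Q x)) -> 0 < e ->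
  \forall x \near F, within_dist e (arc (P x) (Q x)) (arc p q) /\
    within_dist e (arc p q) (arc (P x) (Q x)).
Proof.
move=> Pp Qq pq PQ e0; apply: filterI.
  have oO : open (\bigcup_(z in arc p q) ball z e).
    by apply: bigcup_open => z _; exact: ball_open.
  have sO : arc p q `<=` \bigcup_(z in arc p q) ball z e.
    by move=> z Az; exists z => //; exact: ballxx.
  apply: (@filterS _ _ FF _ _ _ (arc_upper_cvg Pp Qq pq PQ oO sO)) => x sx w /sx[z Az zw].
  by exists z => //; rewrite distrC -ball_dist.
have /compact_near_coveringP := @arc_compact p q.
apply=> z Az.
have Bz : nbhs z (ball z (e / 2)) by apply: nbhsx_ballx; rewrite divr_gt0.
have lower := arc_lower_cvg (FF := FF) Pp Qq pq PQ Az Bz.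
near=> z' x => /=.
have [w Aw zw] : exists2 w, arc (P x) (Q x) w & ball z (e / 2) w.
  by near: x.
exists w => //.
have : ball z (e / 2) z' by near: z'.
move: zw; rewrite !ball_dist => zw zz'.
by rewrite (le_lt_trans (ler_distD z _ _))// (splitr e) ltrD// distrC.
Unshelve. all: by end_near. Qed.

Lemma size_arc_cvg {X : Type} {F : set_system X} {FF : Filter F}
    (P Q : X -> R * R) p q : P @ F --> p -> Q @ F --> q ->
  f p = f q -> (\forall x \near F, f (P x) = f (Q x)) ->
  (fun x => size_set (arc (P x) (Q x))) @ F --> size_set (arc p q).
Proof.
move=> Pp Qq pq PQ; apply/cvgrPdist_le => e e0.
have e4 : 0 < e / 2 by rewrite divr_gt0.
apply: (@filterS _ _ FF _ _ _ (arc_within_cvg Pp Qq pq PQ e4)) => x [h1 h2].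
have n0 a b : arc a b !=set0 by exists a; exact: arcl.
have := size_set_within (@arc_compact _ _) (n0 _ _) (n0 _ _) (ltW e4) h1.
have := size_set_within (@arc_compact _ _) (n0 _ _) (n0 _ _) (ltW e4) h2.
by rewrite ler_norml; lra.
Qed.

(** If the part of the leaf toward the end [b] of [I] were bounded, it would be compact. Its image
    under [u] would be a compact subset of [I] accumulating at [b], which is outside [I]. *)
Lemma leaf_unbounded c (a b M : R) : I a -> b = 0 \/ b = 1 ->
  exists p, [/\ f p = c, betw a b (u p) & M < `|p|].
Proof.
move=> Ia b01; apply: contrapT => nex.
pose A := [set p | f p = c /\ betw a b (u p)].
have Abnd p : A p -> `|p| <= M.
  by move=> [fp bp]; rewrite leNgt; apply/negP => Mp; apply: nex; exists p.
have clA : closed A.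
  have clL : closed (f @^-1` [set c]).
    by apply: preimage_closed => //; exact: closed_eq.
  have clB : closed [set x | betw a b x] by rewrite betw_set; exact: interval_closed.
  have /continuous_closedP/(_ _ clB)/closed_subspaceP[V clV VE] := @u_cont c.
  suff -> : A = V `&` f @^-1` [set c] by exact: closedI.
  by rewrite VE setIC.
have cA : compact A.
  have cB : compact (`[- M, M]%classic `*` `[- M, M]%classic : set (R * R)).
    by apply: compact_setX; exact: segment_compact.
  apply: (subclosed_compact clA cB).
  move=> p /Abnd; rewrite prod_normE ge_max !ler_norml /= !in_itv /= => /andP[? ?].
  by split.
have : closed (u @` A).
  apply: compact_closed; first exact: norm_hausdorff.
  apply: continuous_compact => //; apply: (continuous_subspaceW _ (@u_cont c)).
  by move=> p [].
move=> /(_ b); suff clb : closure (u @` A) b.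
  move=> /(_ clb)[p _ upb]; have := (uK p).1.
  by rewrite upb /unit_interval /= in_itv /=; case: b01 => ->; rewrite ltxx ?andbF.
move=> W /nbhs_ballP[e /= e0 eW].
(* The bound [1 / 2] keeps the point [x] below between [a] and [b] and inside [I]; the bound [e / 2]
   puts it within [e] of [b], since [a] and [b] are less than 1 apart. *)
pose d := Num.min (e / 2) (1 / 2).
have [d0 d1 de] : [/\ 0 < d, d < 1 & d < e].
  by rewrite /d; case: (leP (e / 2) (1 / 2)) => ?; split; lra.
pose x := b + d * (a - b).
have Ia' : 0 < a < 1 by move: Ia; rewrite /unit_interval /= in_itv.
have [Ix bx xb] : [/\ I x, betw a b x & `|b - x| < e].
  by rewrite /unit_interval /= in_itv /= /x /betw; case: b01 => ->; split; try nra;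
   rewrite ltr_norml; nra.
have [fx ux] := gamK c Ix.
exists x; split; first by exists (gam c x) => //; split=> //; rewrite ux.
exact: eW.
Qed.

(** * The leaf coordinate measured from a section *)

Section LocalTrivialization.
Variables (J : set R) (s0 s1 : R -> R * R).
Hypothesis J_open : open J.
Hypothesis s0P : forall c, J c -> f (s0 c) = c /\ {for c, continuous s0}.
Hypothesis s1P : forall c, J c -> f (s1 c) = c /\ {for c, continuous s1}.
Hypothesis s01 : forall c, J c -> s0 c <> s1 c.

(** A single point has nonzero size in general, so the size of the degenerate arc is subtracted to
    get 0 on [s0]. *)
Definition radius p : R :=
  size_set (arc (s0 (f p)) p) - size_set (arc (s0 (f p)) (s0 (f p))).

(** The side is told by an arc rather than by [u], whose orientation may jump from leaf to leaf. *)
Definition negative_side p : Prop := arc p (s1 (f p)) (s0 (f p)).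

Definition height p : R :=
  if `[< negative_side p >] then - radius p else radius p.

Lemma nearJ (p : R * R) : J (f p) -> \forall x \near p, J (f x).
Proof. by move=> Jp; apply: f_cont; apply: open_nbhs_nbhs. Qed.

Lemma section_leaf_cvg (s : R -> R * R) (p : R * R) :
  {for f p, continuous s} -> s (f x) @[x --> p] --> s (f p).
Proof. by move=> cs; apply: continuous_comp => //; exact: f_cont. Qed.

Lemma radius_cvg (p : R * R) : J (f p) -> {for p, continuous radius}.
Proof.
move=> Jp; have [fs cs] := s0P Jp.
have sp := section_leaf_cvg cs.
have fsJ : \forall x \near p, f (s0 (f x)) = f x.
  by apply: filterS (nearJ Jp) => x /s0P[].
apply: cvgB.
  by apply: size_arc_cvg => //; exact: cvg_id.
by apply: size_arc_cvg => //; exact: nearW.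
Qed.

Lemma normr_height p : `|height p| = `|radius p|.
Proof. by rewrite /height; case: ifP; rewrite ?normrN. Qed.

Lemma radius_center c : J c -> radius (s0 c) = 0.
Proof. by move=> /s0P[fs _]; rewrite /radius fs subrr. Qed.

(** Away from [s0] the sign is locally constant: the negative side is open there by [arc_mid_cvg],
    and its complement by [arc_avoid_cvg]. On [s0] the radius vanishes, so the sign does not affect
    the limit. *)
Lemma height_cvg (p : R * R) : J (f p) -> {for p, continuous height}.
Proof.
move=> Jp; have cr := radius_cvg Jp.
have [fs cs] := s0P Jp; have [fs1 cs1] := s1P Jp.
have sp := section_leaf_cvg cs; have sp1 := section_leaf_cvg cs1.
have fsJ : \forall x \near p, f x = f (s0 (f x)).
  by apply: filterS (nearJ Jp) => x /s0P[].
have fs1J : \forall x \near p, f x = f (s1 (f x)).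
  by apply: filterS (nearJ Jp) => x /s1P[].
have idp : x @[x --> p] --> p by exact: cvg_id.
have [neg|pos] := pselect (negative_side p).
  have [ps|ps] := pselect (s0 (f p) = p).
    have r0 : radius p = 0 by rewrite -ps radius_center.
    have h0 : height p = 0 by apply/eqP; rewrite -normr_eq0 normr_height r0 normr0.
    rewrite /prop_for /continuous_at h0; apply/cvgr0Pnorm_lt => e e0.
    have := cr; rewrite /prop_for /continuous_at r0 => /cvgr0Pnorm_lt/(_ e e0).
    by apply: filterS => x; rewrite normr_height.
  have near_neg : \forall x \near p, [/\ negative_side x, s0 (f x) <> x
      & s0 (f x) <> s1 (f x)].
    exact: (arc_mid_cvg idp sp1 sp (esym fs1) fs1J fsJ neg ps (s01 Jp)).
  rewrite /prop_for /continuous_at {2}/height asboolT//.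
  apply: (cvg_trans _ (cvgN cr)); apply: near_eq_cvg.
  by apply: filterS near_neg => x [nx _ _]; rewrite /height asboolT.
have near_pos : \forall x \near p, ~ negative_side x.
  exact: (arc_avoid_cvg idp sp1 sp (esym fs1) fs1J pos).
rewrite /prop_for /continuous_at {2}/height asboolF//.
apply: (cvg_trans _ cr); apply: near_eq_cvg.
by apply: filterS near_pos => x nx; rewrite /height asboolF.
Qed.

Lemma radius_lt p q : J (f p) -> f p = f q ->
  arc (s0 (f p)) p `<=` arc (s0 (f p)) q -> ~ arc (s0 (f p)) p q ->
  radius p < radius q.
Proof.
move=> Jp pq sub nq; rewrite /radius -pq ltrD2r.
apply: (size_set_lt _ _ _ sub _ nq).
- by exists (s0 (f p)); exact: arcl.
- exact: arc_closed.
- exact: arc_compact.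
- by apply: arcr; rewrite (s0P Jp).1.
Qed.

(** The function [v] will be [u] or its opposite, whichever puts [s0] before [s1]; arcs do not see
    the orientation. *)
Lemma height_mono_for (v : R * R -> R) c : J c ->
  (forall p q z, f p = c -> f q = c -> f z = c ->
    arc p q z <-> betw (v p) (v q) (v z)) ->
  v (s0 c) < v (s1 c) ->
  forall p q, f p = c -> f q = c -> v p < v q -> height p < height q.
Proof.
move=> Jc arcv v01.
have [fs0 _] := s0P Jc; have [fs1 _] := s1P Jc.
have negv p : f p = c -> negative_side p <-> v p <= v (s0 c).
  by move=> fp; rewrite /negative_side fp (arcv p)//; rewrite /betw; lra.
have rlt p q : f p = c -> f q = c -> betw (v (s0 c)) (v q) (v p) ->
    ~~ betw (v (s0 c)) (v p) (v q) -> radius p < radius q.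
  move=> fp fq b nb; apply: radius_lt; rewrite ?fp//.
    by apply: arc_sub; [exact: arcl|exact: (proj2 (arcv _ _ _ fs0 fq fp))].
  by move=> /(proj1 (arcv _ _ _ fs0 fp fq)); exact/negP.
move=> p q fp fq vpq.
have hneg z : f z = c -> v z <= v (s0 c) -> height z = - radius z.
  by move=> fz vz; rewrite /height asboolT//; exact: (proj2 (negv z fz)).
have hpos z : f z = c -> v (s0 c) < v z -> height z = radius z.
  by move=> fz vz; rewrite /height asboolF// => /(proj1 (negv z fz)); rewrite leNgt vz.
have rpos z : f z = c -> v z != v (s0 c) -> 0 < radius z.
  move=> fz vz; rewrite -(radius_center Jc); apply: rlt => //; first exact: betwl.
  by apply/negP => /betwxx/eqP; exact/negP.
have [qs|sq] := leP (v q) (v (s0 c)).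
  have ps := le_trans (ltW vpq) qs.
  rewrite !hneg// ltrN2; apply: rlt => //; rewrite /betw; lra.
have [ps|sp] := leP (v p) (v (s0 c)); last first.
  by rewrite !hpos//; apply: rlt => //; rewrite /betw; lra.
(* Here [q] is strictly beyond [s0] and has positive height, while the height of [p] is negative, or
   zero when [p] is on [s0]. *)
rewrite hneg// hpos//.
have rq : 0 < radius q by apply: rpos; rewrite // gt_eqF.
have [pE|pN] := eqVneq (v p) (v (s0 c)); last by have := rpos p fp pN; lra.
suff -> : p = s0 c by rewrite radius_center//; lra.
have : arc (s0 c) (s0 c) p by apply: (proj2 (arcv _ _ _ fs0 fs0 fp)); rewrite pE betwl.
by rewrite arcxx.
Qed.

Lemma height_mono c : J c ->
  (forall p q, f p = c -> f q = c -> u p < u q -> height p < height q) \/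
  (forall p q, f p = c -> f q = c -> u p < u q -> height q < height p).
Proof.
move=> Jc; have [fs0 _] := s0P Jc; have [fs1 _] := s1P Jc.
have [us|us|us] := ltgtP (u (s0 c)) (u (s1 c)).
- left; apply: height_mono_for => // p q z fp fq fz.
  by split=> [[]|] //; split=> //; rewrite fz.
- right => p q fp fq upq.
  apply: (@height_mono_for (fun z => - u z) c) => //=; rewrite ?ltrN2//.
  move=> {p q fp fq upq} p q z fp fq fz; rewrite betwN.
  by split=> [[]|] //; split=> //; rewrite fz.
- by case: (s01 Jc); apply: leaf_inj us; rewrite fs0.
Qed.

Lemma height_inj p q : J (f p) -> f p = f q -> height p = height q -> p = q.
Proof.
move=> Jp pq hpq; apply: leaf_inj => //.
case: (height_mono Jp) => mono.
  have [upq|upq|//] := ltgtP (u p) (u q).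
    by have := mono _ _ erefl (esym pq) upq; rewrite hpq ltxx.
  by have := mono _ _ (esym pq) erefl upq; rewrite hpq ltxx.
have [upq|upq|//] := ltgtP (u p) (u q).
  by have := mono _ _ erefl (esym pq) upq; rewrite hpq ltxx.
by have := mono _ _ (esym pq) erefl upq; rewrite hpq ltxx.
Qed.

(** On a leaf the height is strictly monotone in [u], and betweenness is insensitive to a reversal
    of order. *)
Lemma height_betw p q z : J (f p) -> f p = f q -> f z = f p ->
  betw (height p) (height q) (height z) = betw (u p) (u q) (u z).
Proof.
move=> Jp pq zp.
have mono3 (h v : R * R -> R) :
    (forall x y, f x = f p -> f y = f p -> v x < v y -> h x < h y) ->
    (forall x y, f x = f p -> f y = f p -> v x = v y -> h x = h y) ->
    betw (h p) (h q) (h z) = betw (v p) (v q) (v z).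
  move=> mlt meq.
  have mle x y : f x = f p -> f y = f p -> (h x <= h y) = (v x <= v y).
    move=> fx fy; have [vxy|vyx|vxy] := ltgtP (v x) (v y).
    - by rewrite ltW// mlt.
    - by rewrite leNgt mlt.
    - by rewrite (meq x y) ?lexx.
  by rewrite /betw !mle.
have ueq (h : R * R -> R) x y : f x = f p -> f y = f p -> u x = u y -> h x = h y.
  by move=> fx fy uxy; rewrite (@leaf_inj x y)// fx.
case: (height_mono Jp) => mono; first exact: mono3 mono (ueq _).
rewrite -betwN; apply: (mono3 (fun x => - height x)).
  by move=> x y fx fy uxy; rewrite ltrN2; exact: mono.
exact: ueq.
Qed.

(** The size of an arc dominates the norm of its end, and the leaf is unbounded toward both ends of
    [I]; monotonicity gives the two far points opposite signs. *)
Lemma height_unbounded c M : J c ->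
  exists p q, [/\ f p = c, f q = c, height p < - M & M < height q].
Proof.
move=> Jc; have [fs0 _] := s0P Jc.
have h0 : height (s0 c) = 0.
  by apply/eqP; rewrite -normr_eq0 normr_height radius_center// normr0.
have far b : b = 0 \/ b = 1 ->
    exists p, [/\ f p = c, betw (u (s0 c)) b (u p) & Num.max 0 M < `|height p|].
  move=> b01.
  (* The added term makes up for the size subtracted in [radius]; the maximum with 0 forces the
     point off [s0]. *)
  have [p [fp bp Mp]] := leaf_unbounded c (Num.max 0 M + `|size_set (arc (s0 c) (s0 c))|)
    (uK (s0 c)).1 b01.
  exists p; split=> //; rewrite normr_height /radius fp.
  have : `|p| <= size_set (arc (s0 c) p).
    by apply: norm_le_size_set; [exact: arc_compact|apply: arcr; rewrite fs0].
  have := ler_norm (size_set (arc (s0 c) (s0 c))).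
  have := ler_norm (size_set (arc (s0 c) p) - size_set (arc (s0 c) (s0 c))).
  lra.
have [p [fp bp hp]] := far 0 (or_introl erefl).
have [q [fq bq hq]] := far 1 (or_intror erefl).
have us := (uK (s0 c)).1; have up := (uK p).1; have uq := (uK q).1.
move: us up uq; rewrite /unit_interval /= !in_itv /= => us up uq.
have {}bp : u p <= u (s0 c) by move: bp; rewrite /betw; lra.
have {}bq : u (s0 c) <= u q by move: bq; rewrite /betw; lra.
move: hp hq; rewrite !gt_max => /andP[hp0 hpM] /andP[hq0 hqM].
have neq z : f z = c -> 0 < `|height z| -> u z != u (s0 c).
  move=> fz; apply: contraTneq => uz.
  by rewrite (@leaf_inj z (s0 c)) ?h0 ?normr0 ?ltxx// fz.
have {}bp : u p < u (s0 c) by rewrite lt_neqAle neq.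
have {}bq : u (s0 c) < u q by rewrite lt_neqAle eq_sym neq.
case: (height_mono Jc) => mono.
  have hp := mono _ _ fp fs0 bp; have hq := mono _ _ fs0 fq bq.
  exists p, q; rewrite h0 in hp hq.
  by move: hpM hqM; rewrite (ltr0_norm hp) (gtr0_norm hq); split=> //; lra.
have hp := mono _ _ fp fs0 bp; have hq := mono _ _ fs0 fq bq.
exists q, p; rewrite h0 in hp hq.
by move: hpM hqM; rewrite (ltr0_norm hq) (gtr0_norm hp); split=> //; lra.
Qed.

Lemma height_surj c w : J c -> exists p, f p = c /\ height p = w.
Proof.
move=> Jc; have [p [q [fp fq hp hq]]] := height_unbounded (`|w| + 1) Jc.
have : connected (height @` arc p q).
  apply: connected_continuous_connected; first exact: arc_connected.
  apply: continuous_in_subspaceT => z; rewrite inE => -[fz _].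
  by apply: height_cvg; rewrite fz fp.
move=> /connected_intervalP ih.
have [z [fz _] hz] : (height @` arc p q) w.
  apply: (ih (height p) (height q)).
  - by exists p => //; exact: arcl.
  - by exists q => //; apply: arcr; rewrite fp.
  - have := ler_norm w; have := ler_norm (- w); rewrite normrN; lra.
by exists z; rewrite fz.
Qed.

Definition height_inv (x : R * R) : R * R :=
  xget (0, 0) [set p | f p = x.2 /\ height p = x.1].

Lemma height_invP w c : J c ->
  f (height_inv (w, c)) = c /\ height (height_inv (w, c)) = w.
Proof.
move=> /(height_surj w)[p hp]; rewrite /height_inv.
by case: xgetP => [q _ //|/(_ p)].
Qed.

Lemma height_invK p : J (f p) -> height_inv (height p, f p) = p.
Proof.
by move=> Jp; have [? ?] := height_invP (height p) Jp; apply: height_inj; congruence.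
Qed.

(** The point [p] is enclosed in a leaf arc contained in [V], whose ends are carried to nearby
    leaves by local sections. There the heights of the ends still straddle the given height and the
    arc stays in [V], so it traps the value of [height_inv]. *)
Lemma height_inv_cvg w c : J c -> {for (w, c), continuous height_inv}.
Proof.
move=> Jc; have [] := height_invP w Jc; set p := height_inv _ => fp hp.
move=> O; rewrite /continuous_at -/p nbhsE => -[V [oV Vp] VO].
have [Iup gp] := uK p; rewrite fp in gp.
have : \forall x \near u p, I x /\ V (gam c x).
  have nI : \forall x \near u p, I x.
    by apply: open_nbhs_nbhs; split=> //; exact: interval_open.
  have /within_nearP/(_ _ Iup V) := @gam_cont c.
  rewrite gp => /(_ (open_nbhs_nbhs (conj oV Vp))) nO.
  by apply: (filterS2 _ _ nI nO) => x Ix /(_ Ix).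
move=> /nbhs_ballP[e /= e0 He].
have inball x : `|u p - x| < e -> I x /\ V (gam c x) by move=> h; exact: He.
have [I1 _] : I (u p - e / 2) /\ V (gam c (u p - e / 2)).
  by apply: inball; rewrite opprB addrC subrK gtr0_norm; lra.
have [I2 _] : I (u p + e / 2) /\ V (gam c (u p + e / 2)).
  by apply: inball; rewrite opprD addNKr normrN gtr0_norm; lra.
have [f1 u1] := gamK c I1; have [f2 u2] := gamK c I2.
set p1 := gam c (u p - e / 2) in f1 u1; set p2 := gam c (u p + e / 2) in f2 u2.
have sO : arc p1 p2 `<=` V.
  move=> z [fz bz]; have [_ <-] := uK z; rewrite fz f1.
  apply: (inball _ _).2; move: bz; rewrite u1 u2 /betw => bz.
  by rewrite ltr_norml; lra.
have [fs cs] := s0P Jc.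
have Pc : (fun x : R * R => s0 x.2) @ (w, c) --> s0 c.
  apply: (@continuous_comp _ _ _ snd s0 (w, c)); [exact: cvg_snd|exact: cs].
have nJ : \forall x \near (w, c), J x.2.
  have nJc : nbhs c J by exact: open_nbhs_nbhs.
  exact: (cvg_snd nJc).
have [Z1 [Z1c fZ1]] := section_cvg (z := p1) Pc (etrans fs (esym f1)).
have [Z2 [Z2c fZ2]] := section_cvg (z := p2) Pc (etrans fs (esym f2)).
have h1 : height \o Z1 @ (w, c) --> height p1.
  by apply: (cvg_comp _ _ Z1c); apply: height_cvg; rewrite f1.
have h2 : height \o Z2 @ (w, c) --> height p2.
  by apply: (cvg_comp _ _ Z2c); apply: height_cvg; rewrite f2.
have wc : fst @ (w, c) --> w by exact: cvg_fst.
have near_lt (a b : R * R -> R) (a0 b0 : R) : a @ (w, c) --> a0 -> b @ (w, c) --> b0 ->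
    a0 < b0 -> \forall x \near (w, c), a x < b x.
  move=> aa bb ab; near=> x.
  rewrite (@lt_trans _ _ ((a0 + b0) / 2))//; near: x.
    by apply: (cvgr_lt a0) => //; lra.
  by apply: (cvgr_gt b0) => //; lra.
have nb : \forall x \near (w, c), betw (height (Z1 x)) (height (Z2 x)) x.1.
  case: (height_mono Jc) => mono.
    have hp1 : height p1 < w by rewrite -hp; apply: mono; rewrite ?u1//; lra.
    have hp2 : w < height p2 by rewrite -hp; apply: mono; rewrite ?u2//; lra.
    apply: filterS2 (near_lt _ _ _ _ h1 wc hp1) (near_lt _ _ _ _ wc h2 hp2).
    by move=> x /= ? ?; rewrite /betw; lra.
  have hp1 : w < height p1 by rewrite -hp; apply: mono; rewrite ?u1//; lra.
  have hp2 : height p2 < w by rewrite -hp; apply: mono; rewrite ?u2//; lra.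
  apply: filterS2 (near_lt _ _ _ _ wc h1 hp1) (near_lt _ _ _ _ h2 wc hp2).
  by move=> x /= ? ?; rewrite /betw; lra.
have fZ : \forall x \near (w, c), [/\ J x.2, f (Z1 x) = x.2 & f (Z2 x) = x.2].
  near=> x; have Jx : J x.2 by near: x.
  have [fsx _] := s0P Jx.
  have e1 : f (Z1 x) = f (s0 x.2) by near: x.
  have e2 : f (Z2 x) = f (s0 x.2) by near: x.
  by rewrite e1 e2 fsx.
have fZ12 : \forall x \near (w, c), f (Z1 x) = f (Z2 x).
  by apply: filterS fZ => x [_ -> ->].
have sA : \forall x \near (w, c), arc (Z1 x) (Z2 x) `<=` V.
  exact: (arc_upper_cvg Z1c Z2c (etrans f1 (esym f2)) fZ12 oV sO).
suff : \forall x \near (w, c), O (height_inv x) by [].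
near=> x; apply: VO.
have [Jx fZ1x fZ2x] : [/\ J x.2, f (Z1 x) = x.2 & f (Z2 x) = x.2] by near: x.
have sAx : arc (Z1 x) (Z2 x) `<=` V by near: x.
apply: sAx.
have [fx hx] := height_invP x.1 Jx; rewrite -surjective_pairing in fx hx.
split; first by rewrite fx.
rewrite -height_betw ?fZ1x ?fZ2x// hx.
by near: x.
Unshelve. all: by end_near. Qed.

End LocalTrivialization.


(** * From leaf coordinates to a trivialization of the plane *)

Lemma local_trivialization c : exists2 d, 0 < d &
  exists t g, trivialization f `[c - d, c + d] t g.
Proof.
(* The parameters 1/3 and 1/2 stand for any two distinct points of the leaf; the sections through
   them stay distinct near [c]. *)
have I3 : I (1 / 3) by rewrite /unit_interval /= in_itv /=; lra.
have I2 : I (1 / 2) by rewrite /unit_interval /= in_itv /=; lra.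
have [f0 u0] := gamK c I3; have [f1 u1] := gamK c I2.
have [s0 [s0E s0n]] := local_section f_cont (reg (gam c (1 / 3))).
have [s1 [s1E s1n]] := local_section f_cont (reg (gam c (1 / 2))).
rewrite f0 in s0E s0n; rewrite f1 in s1E s1n.
have ns01 : \forall x \near c, s0 x <> s1 x.
  have c0 : s0 @ c --> gam c (1 / 3).
    by rewrite -s0E; exact: (nbhs_singleton s0n).2.
  have c1 : s1 @ c --> gam c (1 / 2).
    by rewrite -s1E; exact: (nbhs_singleton s1n).2.
  (* Distinctness is written as avoidance of a degenerate arc, which persists on nearby leaves. *)
  have na : ~ arc (gam c (1 / 3)) (gam c (1 / 3)) (gam c (1 / 2)).
    by move=> [_]; rewrite u0 u1 => /betwxx; lra.
  have : \forall x \near c, ~ arc (s0 x) (s0 x) (s1 x).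
    by apply: (arc_avoid_cvg c0 c0 c1 _ _ na) => //; exact: nearW.
  by apply: filterS => x nx s01; apply: nx; rewrite s01; exact: arcl.
have : \forall x \near c, [/\ f (s0 x) = x /\ {for x, continuous s0},
    f (s1 x) = x /\ {for x, continuous s1} & s0 x <> s1 x].
  by near=> x; split; near: x.
move=> /nbhs_ballP[e /= e0 He].
have Jo : open (ball c e) by exact: ball_open.
have J0 x : ball c e x -> f (s0 x) = x /\ {for x, continuous s0} by case/He.
have J1 x : ball c e x -> f (s1 x) = x /\ {for x, continuous s1} by case/He.
have J01 x : ball c e x -> s0 x <> s1 x by case/He.
exists (e / 2); first by rewrite divr_gt0.
exists (height s0 s1), (height_inv s0 s1).
have sub x : `[c - e / 2, c + e / 2]%classic x -> ball c e x.
  rewrite /= in_itv /= -ball_normE /= ltr_distlC; lra.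
split.
- by move=> w x /sub Jx; exact: height_invP Jx.
- by move=> p /sub Jp; exact: height_invK Jp.
- apply: continuous_in_subspaceT => p; rewrite inE => /sub Jp.
  exact: height_cvg Jp.
- apply: continuous_in_subspaceT => -[w x]; rewrite inE => -[_ /sub Jx].
  exact: height_inv_cvg Jx.
Unshelve. all: by end_near. Qed.

Lemma global_trivialization :
  exists (t : R * R -> R) (g : R * R -> R * R), [/\ continuous t, continuous g,
    forall x, f (g x) = x.2 /\ t (g x) = x.1 & forall p, g (t p, f p) = p].
Proof.
apply: (trivialization_setT f_cont) => n.
apply: (trivialization_segment f_cont local_trivialization).
by apply: (@le_trans _ _ 0); rewrite ?oppr_le0.
Qed.

End Leaves.

(** * Stretching an open interval to the line *)

Section IntervalLine.
Variable R : realType.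
Implicit Types (a b : \bar R) (c : R).

Definition pole b c : R := if b is s%:E then (s - c)^-1 else 0.

Lemma pole_nondecreasing b c c' : (c'%:E < b)%E -> c <= c' -> pole b c <= pole b c'.
Proof.
case: b => [s| |] //=; rewrite lte_fin => cs cc.
by rewrite lef_pV2 ?posrE; lra.
Qed.

Lemma pole_continuous b c : (c%:E < b)%E -> {for c, continuous (pole b)}.
Proof.
case: b => [s| |] //= cs; last exact: cvg_cst.
move: cs; rewrite lte_fin => cs.
apply: (@cvgV _ _ _ _ (fun c => s - c)); first by rewrite subr_eq0 gt_eqF.
by apply: cvgB; [exact: cvg_cst|exact: cvg_id].
Qed.

Lemma pole_unbounded b c M : (c%:E < b)%E ->
  exists c', [/\ c <= c', (c'%:E < b)%E & M < c' + pole b c'].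
Proof.
case: b => [s| |] //=; last first.
  move=> _; exists (Num.max c (M + 1)); split; rewrite ?ltry//.
    by rewrite le_max lexx.
  by rewrite addr0 lt_max; apply/orP; right; lra.
(* The value [m] is what the pole must reach for the sum to exceed [M] at any point after [c]; the
   floor 1 makes [m] positive. The other bound on [d] keeps the witness [s - d] after [c]. *)
rewrite lte_fin => cs; pose m := Num.max 1 (M - c + 1).
have m1 : 1 <= m by rewrite le_max lexx.
have Mm : M - c + 1 <= m by rewrite le_max lexx orbT.
pose d := Num.min (s - c) m^-1.
have d0 : 0 < d by rewrite lt_min invr_gt0; apply/andP; split; lra.
have dsc : d <= s - c by rewrite ge_min lexx.
have dm : m <= d^-1.
  rewrite -[m]invrK lef_pV2 ?posrE ?invr_gt0//; last lra.
  by rewrite ge_min lexx orbT.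
exists (s - d); rewrite lte_fin subKr.
by split; [|lra|]; lra.
Qed.

(* Each [pole] blows up at a finite end and vanishes at an infinite one. *)
Definition stretch a b c : R := c - pole (- a)%E (- c) + pole b c.

Lemma open_intervalN a c : ((- c)%:E < - a)%E = (a < c%:E)%E.
Proof. by rewrite EFinN lteN2. Qed.

Lemma stretch_lt a b c c' : open_interval a b c -> open_interval a b c' ->
  c < c' -> stretch a b c < stretch a b c'.
Proof.
move=> /andP[ac cb] /andP[ac' c'b] cc.
have h1 := pole_nondecreasing c'b (ltW cc).
have h2 : pole (- a)%E (- c') <= pole (- a)%E (- c).
  by apply: pole_nondecreasing; rewrite ?open_intervalN// lerN2 ltW.
by rewrite /stretch; lra.
Qed.

Lemma stretch_continuous a b c : open_interval a b c ->
  {for c, continuous (stretch a b)}.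
Proof.
move=> /andP[ac cb]; apply: cvgD; last exact: pole_continuous.
apply: cvgB; first exact: cvg_id.
apply: (@continuous_comp _ _ _ -%R (pole (- a)%E)); first exact: cvgN.
by apply: pole_continuous; rewrite open_intervalN.
Qed.

Lemma stretch_surj a b c w : open_interval a b c ->
  exists2 x, open_interval a b x & stretch a b x = w.
Proof.
move=> /[dup] Ic /andP[ac cb].
(* The threshold absorbs the pole of the opposite end, which is at most its value at [c] from there
   on. *)
have [x [cx xb hx]] := pole_unbounded (`|w| + pole (- a)%E (- c)) cb.
have Nac : ((- c)%:E < - a)%E by rewrite open_intervalN.
have [y [cy ya hy]] := pole_unbounded (`|w| + pole b c) Nac.
have yc : - y <= c by lra.
have ay : (a < (- y)%:E)%E by rewrite -open_intervalN opprK.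
have Ix : open_interval a b x.
  by apply/andP; split=> //; apply: lt_le_trans ac _; rewrite lee_fin.
have Iy : open_interval a b (- y).
  by apply/andP; split=> //; apply: le_lt_trans cb; rewrite lee_fin.
have hxw : `|w| < stretch a b x.
  have : pole (- a)%E (- x) <= pole (- a)%E (- c).
    by apply: pole_nondecreasing; rewrite ?open_intervalN// lerN2.
  by rewrite /stretch; lra.
have hyw : stretch a b (- y) < - `|w|.
  have : pole b (- y) <= pole b c by apply: pole_nondecreasing.
  by rewrite /stretch opprK; lra.
have : connected (stretch a b @` open_interval a b).
  apply: connected_continuous_connected; last first.
    apply: continuous_in_subspaceT => z; rewrite inE; exact: stretch_continuous.
  apply/connected_intervalP => p q /andP[ap pb] /andP[aq qb] z /andP[pz zq].
  apply/andP; split; first by apply: lt_le_trans ap _; rewrite lee_fin.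
  by apply: le_lt_trans qb; rewrite lee_fin.
move=> /connected_intervalP itv.
have [z Iz zw] : (stretch a b @` open_interval a b) w.
  apply: (itv (stretch a b (- y)) (stretch a b x)).
  - by exists (- y).
  - by exists x.
  - by have := ler_norm w; have := ler_norm (- w); rewrite normrN; lra.
by exists z.
Qed.

Lemma open_interval_open a b : open (open_interval a b).
Proof.
have -> : open_interval a b = [set y | (a < y%:E)%E] `&` [set y | (y%:E < b)%E].
  by apply/seteqP; split=> y /= /andP.
apply: openI.
  case: a => [r| |] /=.
  - have -> : [set y : R | (r%:E < y%:E)%E] = [set y | r < y].
      by apply/seteqP; split=> y /=; rewrite lte_fin.
    exact: open_gt.
  - have -> : [set y : R | (+oo < y%:E)%E] = set0 by apply/seteqP; split.
    exact: open0.
  - have -> : [set y : R | (-oo < y%:E)%E] = setT.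
      by apply/seteqP; split=> // y _ /=; rewrite ltNyr.
    exact: openT.
case: b => [r| |] /=.
- have -> : [set y : R | (y%:E < r%:E)%E] = [set y | y < r].
    by apply/seteqP; split=> y /=; rewrite lte_fin.
  exact: open_lt.
- have -> : [set y : R | (y%:E < +oo)%E] = setT.
    by apply/seteqP; split=> // y _ /=; rewrite ltry.
  exact: openT.
- have -> : [set y : R | (y%:E < -oo)%E] = set0 by apply/seteqP; split.
  exact: open0.
Qed.

Lemma open_interval_line a b c : open_interval a b c ->
  exists k l : R -> R, [/\ {in open_interval a b, continuous k}, continuous l,
    (forall x, open_interval a b x -> l (k x) = x)
    & forall w, open_interval a b (l w) /\ k (l w) = w].
Proof.
move=> Ic; pose l w := xget c [set x | open_interval a b x /\ stretch a b x = w].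
have lP w : open_interval a b (l w) /\ stretch a b (l w) = w.
  rewrite /l; case: xgetP => [x _ []//|none].
  by have [x Ix xw] := stretch_surj w Ic; case: (none x).
have lK x : open_interval a b x -> l (stretch a b x) = x.
  move=> Ix; have [Il lx] := lP (stretch a b x).
  have [lt|lt|//] := ltgtP (l (stretch a b x)) x.
    by have := stretch_lt Il Ix lt; rewrite lx ltxx.
  by have := stretch_lt Ix Il lt; rewrite lx ltxx.
exists (stretch a b), l; split=> //.
  by move=> x; rewrite inE; exact: stretch_continuous.
move=> w; have [Il lw] := lP w.
have nI : \forall x \near l w, open_interval a b x.
  by apply: open_nbhs_nbhs; split=> //; exact: open_interval_open.
rewrite -lw; apply: (nbhs_singleton (near_can_continuous (f := stretch a b) _ _)).
  by apply: filterS nI => x; exact: lK.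
by apply: filterS nI => x; exact: stretch_continuous.
Qed.

Lemma open_is_interval (A : set R) : open A -> is_interval A ->
  A = open_interval (ereal_inf (EFin @` A)) (ereal_sup (EFin @` A)).
Proof.
move=> oA iA; apply/seteqP; split=> [x Ax|x /andP[]].
  have /nbhs_ballP[e /= e0 He] : nbhs x A by exact: open_nbhs_nbhs.
  have lo : A (x - e / 2).
    by apply: He; rewrite -ball_normE /= opprB addrC subrK gtr0_norm; lra.
  have hi : A (x + e / 2).
    by apply: He; rewrite -ball_normE /= opprD addNKr normrN gtr0_norm; lra.
  apply/andP; split.
    apply: (@le_lt_trans _ _ (x - e / 2)%:E); last by rewrite lte_fin; lra.
    by apply: ereal_inf_lbound; exists (x - e / 2).
  apply: (@lt_le_trans _ _ (x + e / 2)%:E); first by rewrite lte_fin; lra.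
  by apply: ereal_sup_ubound; exists (x + e / 2).
move=> /ereal_inf_lt[_ [y Ay <-]] yx /ereal_sup_gt[_ [z Az <-]] xz.
move: yx xz; rewrite !lte_fin => yx xz.
by apply: (iA y z) => //; rewrite !ltW.
Qed.

End IntervalLine.

(** * The image is an open interval *)

Section Image.
Variables (R : realType) (f : R * R -> R).
Hypothesis f_cont : continuous f.

Lemma range_is_interval : is_interval (range f).
Proof.
move=> _ _ [p _ <-] [q _ <-] z pzq.
pose L (s : R) : R * R := (p.1 + s * (q.1 - p.1), p.2 + s * (q.2 - p.2)).
have cL : continuous L.
  have c1 (x y : R) : continuous (fun s : R => x + s * (y - x)).
    move=> s; apply: cvgD; first exact: cvg_cst.
    by apply: cvgM; [exact: cvg_id|exact: cvg_cst].
  by move=> s; exact: continuous_pair (c1 p.1 q.1 s) (c1 p.2 q.2 s).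
have : connected ((f \o L) @` setT).
  apply: connected_continuous_connected; first by apply/connected_intervalP.
  apply: continuous_subspaceT => s.
  by apply: continuous_comp; [exact: cL|exact: f_cont].
move=> /connected_intervalP itv.
have [s _ fs] : ((f \o L) @` setT) z.
  apply: (itv (f p) (f q)) => //.
    by exists 0 => //=; rewrite /L !mul0r !addr0 -surjective_pairing.
  by exists 1 => //=; rewrite /L !mul1r !subrKC -surjective_pairing.
by exists (L s).
Qed.

Lemma range_open : (forall p, regular_at (level_sets f) p) -> open (range f).
Proof.
move=> reg; rewrite openE => _ [p _ <-].
have [s [_ sn]] := local_section f_cont (reg p).
by apply: filterS sn => c [fs _]; exists (s c).
Qed.

End Image.

(** * Return from the stretched function to [f] *)

Theorem theorem1 (R : realType) (f : R * R -> R) (f_cont : continuous f)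
    (level_curve : forall c : R, range f c -> curve (f @^-1` [set c]))
    (level_regular : regular_family_of_curves setT (level_sets f)) :
  (exists a b : \bar R,
     range f = open_interval a b /\
     exists phi : R * R -> R * R,
       homeomorphism (setT `*` open_interval a b) setT phi /\
       forall x y : R, open_interval a b y -> f (phi (x, y)) = y) /\
  topologically_equivalent f (@projection R).
Proof.
have reg p : regular_at (level_sets f) p by case: level_regular => _ _; exact.
have rangeE := open_is_interval (range_open f_cont reg) (range_is_interval f_cont).
set a := ereal_inf _ in rangeE; set b := ereal_sup _ in rangeE.
have rf p : open_interval a b (f p) by rewrite -rangeE; exists p.
have [k [l [ck cl lk lP]]] := open_interval_line (rf 0).
(* The leaves of [h] are those of [f], but every real is a value of [h], as a trivialization over
   the whole line requires. *)
pose h p := k (f p).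
have ch : continuous h.
  by move=> p; apply: continuous_comp; [exact: f_cont|apply: ck; rewrite inE].
have levelE w : h @^-1` [set w] = f @^-1` [set l w].
  apply/seteqP; split=> p /=; first by move=> <-; rewrite /h lk.
  by rewrite /h => ->; have [_ ->] := lP w.
have levelsE : level_sets h = level_sets f.
  apply/seteqP; split=> _ [c [p _ <-] <-].
    by exists (f p); [exists p|rewrite levelE /h lk].
  by exists (h p); [exists p|rewrite levelE /h lk].
have regh p : regular_at (level_sets h) p by rewrite levelsE.
have hcurve w : exists GU : (R -> R * R) * (R * R -> R),
    [/\ {homo GU.1 : x / unit_interval x >-> (h @^-1` [set w]) x},
        {homo GU.2 : p / (h @^-1` [set w]) p >-> unit_interval p},
        (forall x, unit_interval x -> GU.2 (GU.1 x) = x),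
        (forall p, (h @^-1` [set w]) p -> GU.1 (GU.2 p) = p)
      & {within @unit_interval R, continuous GU.1} /\
        {within h @^-1` [set w], continuous GU.2}].
  have : range f (l w) by rewrite rangeE; case: (lP w).
  rewrite levelE => /level_curve[G [U GU]].
  by exists (G, U).
have [GU GUP] := choice hcurve.
(* One parametrization is chosen per leaf; [u] applies the inverse attached to the level of its
   argument. *)
pose gam w := (GU w).1; pose u p := (GU (h p)).2 p.
have [t [g [ct cg gP gK]]] : exists (t : R * R -> R) (g : R * R -> R * R),
    [/\ continuous t, continuous g,
      forall x, h (g x) = x.2 /\ t (g x) = x.1 & forall p, g (t p, h p) = p].
  apply: (@global_trivialization _ h ch regh gam u).
  - move=> w x Ix; have [homG _ GK _ _] := GUP w.
    have hG : h (gam w x) = w by exact: homG.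
    by split=> //; rewrite /u hG; exact: GK.
  - by move=> p; have [_ homU _ UK _] := GUP (h p); split; [exact: homU|exact: UK].
  - by move=> w; have [_ _ _ _ []] := GUP w.
  - move=> w; have [_ _ _ _ [_ cU]] := GUP w.
    by apply: within_eq cU => p /= hp; rewrite /u hp.
split.
  exists a, b; split=> //.
  (* The fibres of [g] are indexed by values of [h]; composing with [k] indexes them by values of
     [f]. *)
  exists (fun x => g (x.1, k x.2)).
  have fphi x y : open_interval a b y -> f (g (x, k y)) = y.
    move=> Iy; have [hg _] := gP (x, k y).
    by rewrite -(lk _ (rf (g (x, k y)))) -[k (f _)]/(h _) hg lk.
  split=> //; exists (fun p => (t p, f p)); split=> //.
  - by move=> p _; split=> //; exact: rf.
  - by move=> [x y] [_ /= Iy]; rewrite fphi//; have [_ ->] := gP (x, k y).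
  - by move=> p _ /=; rewrite -[k (f p)]/(h p) gK.
  split.
    apply: (within_comp (B := setT) (f := fun x : R * R => (x.1, k x.2))) => //.
      apply: continuous_in_subspaceT => -[x y]; rewrite inE => -[_ /= Iy].
      apply: continuous_pair; first exact: cvg_fst.
      apply: (@continuous_comp _ _ _ snd k); first exact: cvg_snd.
      by apply: ck; rewrite inE.
    exact: continuous_subspaceT.
  apply: continuous_subspaceT => p.
  by apply: continuous_pair; [exact: ct|exact: f_cont].
(* The second coordinate of this homeomorphism is [k \o f] itself, and [k] maps the image of [f]
   onto the line, the range of the projection. *)
exists (fun p => (t p, h p)), k; split=> //.
- exists g; split=> //.
  + by move=> [x y] _; have [-> ->] := gP (x, y).
  split; apply: continuous_subspaceT => // p.
  by apply: continuous_pair; [exact: ct|exact: ch].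
- exists l; split.
  + by move=> y _; exists (0, k y).
  + by move=> y _; rewrite rangeE; case: (lP y).
  + by move=> y; rewrite rangeE; exact: lk.
  + by move=> y _; case: (lP y).
  split; last exact: continuous_subspaceT.
  by rewrite rangeE; exact: continuous_in_subspaceT.
Qed.
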